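(* Assume that for every $\boldsymbol{k}\in\operatorname{Ind}_{\mathrm{BZ}}$ one has $$\varphi^{\pi}(\Theta(\boldsymbol{k}))\in V_{\mathrm{BZ}}\otimes\mathbb{Q}\langle\mathcal{B}\rangle\qquad\text{and}\qquad\varphi^{\pi}(\Theta(\boldsymbol{k}))=(\tau_{\mathrm{BZ}}\otimes\mathrm{id})\bigl(\varphi^{\pi}(\Theta(\boldsymbol{k}^{\dagger}))\bigr).$$ Then $I^{\mathrm{SZ}}_{\mathrm{dual}}\subset I_{\mathrm{CF}}$.
   Context: **Words.** $\mathbb{Q}\langle\mathcal{B}\rangle$ is the free noncommutative $\mathbb{Q}$-algebra on $\mathcal{B}=\{b_0,b_1,b_2,\dots\}$ with empty word $1$; $\mathbb{Q}\langle\mathcal{B}\rangle^{0}$ is the subspace spanned by $1$ and all words not ending with $b_0$. The stuffle product $*$ on $\mathbb{Q}\langle\mathcal{B}\rangle$ is the $\mathbb{Q}$-bilinear map with $1*u=u*1=u$ and $(b_iu)*(b_jv)=b_i(u*b_jv)+b_j(b_iu*v)+b_{i+j}(u*v)$ for $i,j\ge0$. Every $u\in\mathbb{Q}\langle\mathcal{B}\rangle$ is uniquely $u=u_0+u_1*b_0+\cdots+u_k*b_0^{*k}$ with $u_j\in\mathbb{Q}\langle\mathcal{B}\rangle^{0}$; put $\operatorname{reg}_*(u)=u_0$. **Formal $q$MPLs.** $q$ is a fixed complex number with $0<|q|<1$. For $X\subset\mathbb{Z}$, $q^X=\{q^n: n\in X\}$. $\hat{\mathcal{F}}$ is the set of formal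 symbols $\mathbb{L}_{k_1,\dots,k_d}(x_1,\dots,x_d)$ with $d\ge0$, $k_i\in\mathbb{Z}_{\ge1}$, $x_i\in\{z^hq^m: h\in\{0,\pm1\},\,m\in\mathbb{Z}\}$ and $x_i\cdots x_d\in zq^{\mathbb{Z}}\cup q^{\mathbb{Z}_{>0}}$ for $1\le i\le d$; the case $d=0$ is written $\mathbb{L}(\emptyset)$. Weight: $k_1+\cdots+k_d$. For $\mathcal{X}\subset\hat{\mathcal{F}}$, $\mathbb{Q}\mathcal{X}$ is the $\mathbb{Q}$-vector space with basis $\mathcal{X}$. Let $\Omega=\bigoplus_{b\in\{0\}\cup q^{\mathbb{Z}}}\mathbb{Q}e_b$, with formal symbols $e_b$. **Single-position difference $D$.** $\mathbb{L}_{k_1,\dots,k_d}(x_1,\dots,x_d)$ and $\mathbb{L}_{k_1,\dots,k_d}(x'_1,\dots,x'_d)$ in $\hat{\mathcal{F}}$ are adjacent if for some $j$: $x_i=x_i'$ for $i\ne j$, $x_j\in zq^{\mathbb{Z}}\cup z^{-1}q^{\mathbb{Z}}$, $x_j/x_j'\in\{q^{\pm1}\}$. For adjacent $u=\mathbb{L}_{k_1,\dots,k_d}(x_1,\dots,x_d)$ and $v=\mathbb{L}_{k_1,\dots,k_d}(x_1,\dots,qx_j,\dots,x_d)$ put - if $k_j>1$: $D(u,v)=\mathbb{L}_{k_1,\dots,k_j-1,\dots,k_d}(x_1,\dots,x_d)\otimes e_0$; - if $k_j=1$, $x_j=q^mz$: $D(u,v)=-A\otimes e_{q^{-m}}+B\otimes(e_{q^{-m}}-e_0)$;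 - if $k_j=1$, $x_j=q^{-m}z^{-1}$: $D(u,v)=A\otimes(e_{q^{-m}}-e_0)-B\otimes e_{q^{-m}}$; where $A=\mathbb{L}_{k_1,\dots,\widehat{k_j},\dots,k_d}(x_1,\dots,x_{j-1}x_j,\dots,x_d)$ (read as $\mathbb{L}_{k_2,\dots,k_d}(x_2,\dots,x_d)$ if $j=1$) and $B=\mathbb{L}_{k_1,\dots,\widehat{k_j},\dots,k_d}(x_1,\dots,x_jx_{j+1},\dots,x_d)$ (read as $0$ if $j=d$). If instead $v$ is obtained from $u$ by $x_j\mapsto q^{-1}x_j$, put $D(u,v)=-D(v,u)$. **$\mathcal{F}^n$, $\mathcal{F}$, standard path.** For $n\in\mathbb{Z}$, $\mathcal{F}^n$ is the set of $\mathbb{L}_{k_1,\dots,k_d}(x_1,\dots,x_d)\in\hat{\mathcal{F}}$ with $x_i\in\{vq^s: v\in\{1,zq^n,(zq^n)^{-1}\},\,0\le s\le k_i\}$ for all $i$; $\mathcal{F}=\bigcup_n\mathcal{F}^n$. For $u=\mathbb{L}_{k_1,\dots,k_d}(x_1(z),\dots,x_d(z))\in\mathcal{F}$, the level of a $z$-dependent position $i$ is the unique integer $r$ with $x_i=zq^r$ or $x_i=z^{-1}q^{1-r}$. Levels are computed from $u$ and remain fixed. Starting from $u$, replace the $z$-dependent entries one at a time by $x_i(z)\mapsto x_i(zq)$, in increasing order of level, entries of equal level from right to left. The resulting sequence $\operatorname{Std}(u)=(u_0,\dots,u_l)$, $u_0=u(z)$, $u_l=u(zq)$, is the standard path; it consists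 of elements of $\hat{\mathcal{F}}$ with consecutive ones adjacent. **$\partial$, $S$, $\varphi$.** $\partial\colon\mathbb{Q}\mathcal{F}\to\mathbb{Q}\mathcal{F}\otimes\Omega$ is $\mathbb{Q}$-linear with $\partial(u)=\sum_{i=1}^lD(u_{i-1},u_i)$ for $u\in\mathcal{F}$, $\operatorname{Std}(u)=(u_0,\dots,u_l)$; it lowers weight by one. $\mathcal{C}$ is the set of $z$-independent elements of $\mathcal{F}$. $\hat{\mathcal{C}}_z=\{\mathbb{L}_{k_1,\dots,k_d}(q^{n_1},\dots,q^{n_{d-1}},zq^{n_d}): d\ge1,n_i\in\mathbb{Z}\}\cup\{\mathbb{L}(\emptyset)\}$ and $\mathcal{C}^n_z=\{\mathbb{L}_{k_1,\dots,k_d}(q^{n_1},\dots,q^{n_{d-1}},zq^{n+n_d}): d\ge1,\,0\le n_i\le k_i\}\cup\{\mathbb{L}(\emptyset)\}$. $S\colon\mathbb{Q}\hat{\mathcal{C}}_z\otimes\Omega\to\mathbb{Q}\hat{\mathcal{C}}_z$ is $\mathbb{Q}$-linear with, for $d\ge1$, $S(\mathbb{L}_{k_1,\dots,k_d}(q^{n_1},\dots,zq^{n_d})\otimes e_0)=\mathbb{L}_{k_1,\dots,k_{d-1},k_d+1}(q^{n_1},\dots,zq^{n_d})$, $S(\mathbb{L}_{k_1,\dots,k_d}(q^{n_1},\dots,zq^{n_d})\otimes e_{q^{-r}})=-\mathbb{L}_{k_1,\dots,k_d,1}(q^{n_1},\dots,q^{n_{d-1}},q^{n_d-r},zq^r)$,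 $S(\mathbb{L}(\emptyset)\otimes e_{q^{-r}})=-\mathbb{L}_1(zq^r)$, $S(\mathbb{L}(\emptyset)\otimes e_0)=0$. The $\mathbb{Q}$-linear map $\varphi\colon\mathbb{Q}\mathcal{F}\to\mathbb{Q}\mathcal{C}\otimes\mathbb{Q}\hat{\mathcal{C}}_z$ is defined recursively on weight by $\varphi=(\mathrm{id}_{\mathbb{Q}\mathcal{C}}\otimes S)\circ(\varphi\otimes\mathrm{id}_\Omega)\circ\partial+\mathrm{Const}$, where for $u\in\mathcal{F}$, $\mathrm{Const}(u)=u\otimes\mathbb{L}(\emptyset)$ if $u\in\mathcal{C}$ and $0$ otherwise. One has $\varphi(\mathbb{Q}\mathcal{F}^n)\subset\mathbb{Q}\mathcal{C}\otimes\mathbb{Q}\mathcal{C}^n_z$. **$\pi$, $\pi_z$, $\varphi^\pi$.** For integers $0\le n_i\le k_i$ put $$F(k_1,\dots,k_d;n_1,\dots,n_d)=\sum_{s_1=0}^{k_1-n_1}\cdots\sum_{s_d=0}^{k_d-n_d}\left(\prod_{i=1}^d\binom{k_i-n_i}{s_i}\right)b_{k_1-s_1}\cdots b_{k_d-s_d}.$$ The $\mathbb{Q}$-linear maps $\pi\colon\mathbb{Q}\mathcal{C}\to\mathbb{Q}\langle\mathcal{B}\rangle^0$ and $\pi_z\colon\mathbb{Q}\mathcal{C}^0_z\to\mathbb{Q}\langle\mathcal{B}\rangle$ are $\pi(\mathbb{L}_{k_1,\dots,k_d}(q^{n_1},\dots,q^{n_d}))=\pi_z(\mathbb{L}_{k_1,\dots,k_d}(q^{n_1},\dots,q^{n_{d-1}},zq^{n_d}))=F(k_1,\dots,k_d;n_1,\dots,n_d)$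 and $\pi(\mathbb{L}(\emptyset))=\pi_z(\mathbb{L}(\emptyset))=1$. Put $\varphi^\pi=(\pi\otimes\pi_z)\circ\varphi\colon\mathbb{Q}\mathcal{F}^0\to\mathbb{Q}\langle\mathcal{B}\rangle^0\otimes\mathbb{Q}\langle\mathcal{B}\rangle$. **Confluence relations.** $\mathcal{G}=\{\mathbb{L}_{k_1,\dots,k_d}(x_1,\dots,x_d)\in\mathcal{F}^0: d=0\text{ or }x_d\ne z\}$; for $u\in\mathbb{Q}\mathcal{G}$, $u|_{z=1}\in\mathbb{Q}\mathcal{C}$ is obtained by setting $z=1$ in all arguments. $\mathcal{S}(\mathbb{Q}\langle\mathcal{B}\rangle^0)$ is the symmetric algebra over $\mathbb{Q}$, with product $\odot$ and unit $1_{\mathcal{S}}$; $1_{\mathbb{Q}\langle\mathcal{B}\rangle^0}$ is the empty word viewed in degree one; $m_\odot(u\otimes v)=u\odot v$. $I^{\mathrm{alg}}_{\mathrm{CF}}$ is the ideal of $\mathcal{S}(\mathbb{Q}\langle\mathcal{B}\rangle^0)$ generated by $1_{\mathbb{Q}\langle\mathcal{B}\rangle^0}-1_{\mathcal{S}}$ and all $m_\odot\circ(\mathrm{id}\otimes\operatorname{reg}_* )\circ\varphi^\pi(u)-\pi(u|_{z=1})$, $u\in\mathbb{Q}\mathcal{G}$; and $I_{\mathrm{CF}}=I^{\mathrm{alg}}_{\mathrm{CF}}\cap\mathbb{Q}\langle\mathcal{B}\rangle^0$. **BZ and SZ dual indices.** For $a\in\{0,1\}$, $\{a\}^r$ denotes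 $r$ copies of $a$. $\operatorname{Ind}_{\mathrm{BZ}}$ is the set of tuples $\boldsymbol{k}=(k_1,\dots,k_d)\in\mathbb{Z}_{\ge1}^d$ with $d=0$ or $k_d\ge2$. Each such $\boldsymbol{k}$ is uniquely $\boldsymbol{k}=(\{1\}^{d_1-1},c_1+1,\dots,\{1\}^{d_r-1},c_r+1)$ with $c_i,d_i\ge1$; its BZ dual is $\boldsymbol{k}^\dagger=(\{1\}^{c_r-1},d_r+1,\dots,\{1\}^{c_1-1},d_1+1)$. Put $F_{\mathrm{BZ}}(\boldsymbol{k})=(b_{k_1}+b_{k_1-1})\cdots(b_{k_d}+b_{k_d-1})$ and $V_{\mathrm{BZ}}=\operatorname{span}_{\mathbb{Q}}\{F_{\mathrm{BZ}}(\boldsymbol{k}):\boldsymbol{k}\in\operatorname{Ind}_{\mathrm{BZ}}\}\subset\mathbb{Q}\langle\mathcal{B}\rangle^0$ (this family is linearly independent). $\tau_{\mathrm{BZ}}\colon V_{\mathrm{BZ}}\to V_{\mathrm{BZ}}$ is the $\mathbb{Q}$-linear involution with $\tau_{\mathrm{BZ}}(F_{\mathrm{BZ}}(\boldsymbol{k}))=F_{\mathrm{BZ}}(\boldsymbol{k}^\dagger)$. $\operatorname{Ind}_{\mathrm{SZ}}$ is the set of tuples $\boldsymbol{k}=(k_1,\dots,k_d)\in\mathbb{Z}_{\ge0}^d$ with $d=0$ or $k_d\ge1$. Each such $\boldsymbol{k}$ is uniquely $\boldsymbol{k}=(\{0\}^{d_1-1},c_1,\dots,\{0\}^{d_r-1},c_r)$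 with $c_i,d_i\ge1$; its SZ dual is $\boldsymbol{k}^\vee=(\{0\}^{c_r-1},d_r,\dots,\{0\}^{c_1-1},d_1)$. With $b_{\boldsymbol{k}}=b_{k_1}\cdots b_{k_d}$, $\tau_{\mathrm{SZ}}\colon\mathbb{Q}\langle\mathcal{B}\rangle^0\to\mathbb{Q}\langle\mathcal{B}\rangle^0$ is the $\mathbb{Q}$-linear involution with $\tau_{\mathrm{SZ}}(b_{\boldsymbol{k}})=b_{\boldsymbol{k}^\vee}$ for $\boldsymbol{k}\in\operatorname{Ind}_{\mathrm{SZ}}$, and $I^{\mathrm{SZ}}_{\mathrm{dual}}=\operatorname{Im}(\mathrm{id}_{\mathbb{Q}\langle\mathcal{B}\rangle^0}-\tau_{\mathrm{SZ}})$. **$\Theta$.** For $\boldsymbol{k}=(k_1,\dots,k_d)\in\operatorname{Ind}_{\mathrm{BZ}}$, $$\Theta(\boldsymbol{k})=\sum_{\varepsilon_1,\dots,\varepsilon_d\in\{0,1\}}(-1)^{\sum_{i=1}^d\varepsilon_i}\,\mathbb{L}_{k_1,\dots,k_d}\left(q^{k_1-1+\varepsilon_2}z^{\varepsilon_1-\varepsilon_2},\dots,q^{k_d-1+\varepsilon_{d+1}}z^{\varepsilon_d-\varepsilon_{d+1}}\right)\in\mathbb{Q}\mathcal{F}^0,\qquad\varepsilon_{d+1}:=0.$$ *)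

(* Defs.v *)
From HB Require Import structures.
From mathcomp Require Import all_boot all_order all_algebra.
From mathcomp Require Import finmap monalg.
From Stdlib Require Import ClassicalEpsilon.

Set Implicit Arguments.
Unset Strict Implicit.
Unset Printing Implicit Defensive.

Import Order.TTheory GRing.Theory Num.Theory.
Local Open Scope ring_scope.

(* The Q-vector space with basis K is {malg rat[K]}, << k >> being the basis
   vector of k; the tensor product of the spaces with bases K and L is the
   space with basis K * L. *)

Definition supported (K : choiceType) (P : pred K) (u : {malg rat[K]}) : Prop :=
  forall k, k \in msupp u -> P k.

Definition lext (K : choiceType) (V : lmodType rat) (f : K -> V)
    (u : {malg rat[K]}) : V :=
  \sum_(k <- msupp u) u@_k *: f k.

Definition tens (K L : choiceType) (u : {malg rat[K]}) (v : {malg rat[L]}) :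
    {malg rat[(K * L)%type]} :=
  lext (fun a => lext (fun b => << (a, b) >>) v) u.

Definition tmap (K L K' L' : choiceType)
    (f : K -> {malg rat[K']}) (g : L -> {malg rat[L']}) :
    {malg rat[(K * L)%type]} -> {malg rat[(K' * L')%type]} :=
  lext (fun p => tens (f p.1) (g p.2)).

Lemma lextEw (K : choiceType) (V : lmodType rat) (f : K -> V)
    (u : {malg rat[K]}) (d : {fset K}) :
  (msupp u `<=` d)%fset -> lext f u = \sum_(k <- d) u@_k *: f k.
Proof.
move=> le_ud; rewrite /lext (big_fset_incl _ le_ud) //.
by move=> k _ /mcoeff_outdom ->; rewrite scale0r.
Qed.

Lemma lext_is_linear (K : choiceType) (V : lmodType rat) (f : K -> V) :
  linear (lext f).
Proof.
move=> c u v; pose d := (msupp (c *: u + v) `|` msupp u `|` msupp v)%fset.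
rewrite !(@lextEw _ _ _ _ d) /d.
- rewrite scaler_sumr -big_split /=; apply: eq_bigr => k _.
  by rewrite mcoeffD mcoeffZ scalerDl scalerA.
- by rewrite fsubsetUr.
- by rewrite -fsetUA fsetUCA fsubsetUl.
- by rewrite -fsetUA fsubsetUl.
Qed.

HB.instance Definition _ (K : choiceType) (V : lmodType rat) (f : K -> V) :=
  GRing.isLinear.Build rat {malg rat[K]} V *:%R (lext f) (lext_is_linear f).

Lemma lextU (K : choiceType) (V : lmodType rat) (f : K -> V) (k : K) :
  lext f << k >> = f k.
Proof. by rewrite (lextEw _ msuppU_le) big_seq_fset1 mcoeffUU scale1r. Qed.

Lemma lextZU (K : choiceType) (V : lmodType rat) (f : K -> V) (c : rat) (k : K) :
  lext f << c *g k >> = c *: f k.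
Proof. by rewrite (lextEw _ msuppU_le) big_seq_fset1 mcoeffUU. Qed.

Lemma malg_scalerAr (K : monomType) (c : rat) (u v : {malg rat[K]}) :
  u * (c *: v) = c *: (u * v).
Proof.
rewrite (malgMEw (fsubset_refl _) (msuppZ_le c v)) malgME scaler_sumr.
apply: eq_bigr => k _; rewrite scaler_sumr; apply: eq_bigr => k' _.
by apply/malgP => x; rewrite !mcoeffZ !mcoeffU mulrnAr mulrCA.
Qed.

(* The product of Qw is concatenation of words, its unit is the empty word. *)
Notation Qw := {malg rat[{fmonom nat}]}.

Definition b (n : nat) : Qw := << FMonom [:: n] >>.

Definition word (k : seq nat) : Qw := << FMonom k >>.

Definition adm (w : {fmonom nat}) : bool := last 1%N w != 0%N.

Fixpoint stuffle_word (u : seq nat) : seq nat -> Qw :=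
  match u with
  | [::] => word
  | i :: u' =>
      fix aux (v : seq nat) : Qw :=
        match v with
        | [::] => word u
        | j :: v' => b i * stuffle_word u' v + b j * aux v'
                     + b (i + j) * stuffle_word u' v'
        end
  end.

Definition stuffle (u v : Qw) : Qw :=
  lext (fun w : {fmonom nat} => lext (fun w' : {fmonom nat} => stuffle_word w w') v) u.

Definition stuffle_pow (u : Qw) (n : nat) : Qw := iter n (stuffle u) 1.

Definition is_reg (u u0 : Qw) : Prop :=
  exists (c : nat -> Qw) (n : nat),
    [/\ forall j, supported adm (c j),
        u = \sum_(j < n.+1) stuffle (c j) (stuffle_pow (b 0) j)
      & u0 = c 0%N].

Definition reg (u : Qw) : Qw := epsilon (inhabits 0) (is_reg u).

Lemma qpow_inj (C : numFieldType) (q : C) :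
  0 < `|q| < 1 -> injective (fun m : int => q ^ m).
Proof.
case/andP=> q0 q1 m n /=; have q_neq0 : q != 0 by rewrite -normr_gt0.
wlog le_nm : m n / n <= m => [IH E | E].
  by case/orP: (le_total n m) => /IH; [|move=> IH'; apply/esym]; auto.
have [k Dm] : exists k : nat, m = n + k%:Z by exists `|m - n|%N; rewrite gez0_abs ?subr_ge0 // subrKC.
move: E; rewrite {le_nm}Dm expfzDr // -[RHS]mulr1 => /(mulfI (expfz_neq0 _ q_neq0)).
move/(congr1 Num.norm); rewrite normrX normr1.
case: k => [|k] E; first by rewrite addr0.
by have := exprn_ilt1 k.+1 (ltW q0) q1; rewrite E ltxx.
Qed.

(* As 0 < |q| < 1, the arguments z^h q^m are determined by (h, m); they are
   encoded as (h, m), so that their product is addition in int * int. *)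
Notation arg := (int * int)%type.

(* L_{k_1,...,k_d}(x_1,...,x_d) is the sequence of the pairs (k_i, x_i).  The
   functions below are total; only their values on symbols of [in_Fhat] (or,
   for [S_symb], on the empty
   symbol and those whose last argument is in z q^Z) are meaningful. *)
Notation symb := (seq (nat * arg)).

(* None is the index of e_0, and Some m that of e_{q^m}. *)
Notation omega := (option int).

Notation QL := {malg rat[symb]}.
Notation QOmega := {malg rat[omega]}.

Definition dep (u : symb) (i : nat) : nat := (nth (0%N, 0) u i).1.
Definition sarg (u : symb) (i : nat) : arg := (nth (0%N, 0) u i).2.

Definition weight (u : symb) : nat := \sum_(p <- u) p.1.

Definition in_Fhat (u : symb) : bool :=
  all (fun p : nat * arg => (0 < p.1)%N && (p.2.1 \in [:: 0; 1; -1])) u &&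
  all (fun i => let x : arg := \sum_(p <- drop i u) p.2 in
                (x.1 == 1) || (x.1 == 0) && (0 < x.2)) (iota 0 (size u)).

(* z^h q^m = v q^s with v = (z q^n)^h for s = m - n h. *)
Definition in_Fn (n : int) (u : symb) : bool :=
  in_Fhat u &&
  all (fun p : nat * arg => 0 <= p.2.2 - n * p.2.1 <= p.1%:Z) u.

Definition z_free (u : symb) : bool := all (fun p : nat * arg => p.2.1 == 0) u.

(* x_j |-> q^s x_j *)
Definition qshift (s : int) (u : symb) (j : nat) : symb :=
  set_nth (0%N, 0) u j (dep u j, sarg u j + (0, s)).

Definition D_A (u : symb) (j : nat) : symb :=
  if j is i.+1 then
    take i u ++ (dep u i, sarg u i + sarg u j) :: drop j.+1 u
  else behead u.

Definition D_B (u : symb) (j : nat) : QL :=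
  if (j.+1 < size u)%N then
    << take j u ++ (dep u j.+1, sarg u j + sarg u j.+1) :: drop j.+2 u >>
  else 0.

(* D(u, v) for v obtained from u by x_j |-> q x_j. *)
Definition D_up (u : symb) (j : nat) : {malg rat[(symb * omega)%type]} :=
  let e0 : QOmega := << None >> in
  let e (m : int) : QOmega := << Some m >> in
  let A : QL := << D_A u j >> in
  let B := D_B u j in
  let: (h, m) := sarg u j in
  if (1 < dep u j)%N then
    tens << set_nth (0%N, 0) u j ((dep u j).-1, sarg u j) >> e0
  else if h == 1 then - tens A (e (- m)) + tens B (e (- m) - e0)
  else tens A (e m - e0) - tens B (e m).

Definition D (u v : symb) : {malg rat[(symb * omega)%type]} :=
  let j := find (fun p => p.1 != p.2) (zip u v) in
  if v == qshift 1 u j then D_up u j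
  else if v == qshift (-1) u j then - D_up v j
  else 0.

Definition level (x : arg) : int := if x.1 == 1 then x.2 else 1 - x.2.

Definition std_order (u : symb) : seq nat :=
  sort (fun i j => let r := level (sarg u i) in let r' := level (sarg u j) in
                   (r < r') || (r == r') && (j <= i)%N)
    [seq i <- iota 0 (size u) | (sarg u i).1 != 0].

(* Under z |-> z q, the entry z^h q^m becomes z^h q^(m + h). *)
Definition Std (u : symb) : seq symb :=
  u :: scanl (fun v j => qshift (sarg v j).1 v j) u (std_order u).

Definition partial (u : symb) : {malg rat[(symb * omega)%type]} :=
  \sum_(p <- zip (Std u) (behead (Std u))) D p.1 p.2.

Definition S_symb (u : symb) (e : omega) : QL :=
  match e with
  | None => if u is p :: s then
              let l := last p s in
              << rcons (belast p s) (l.1.+1, l.2) >>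
            else 0
  | Some m => (* e_{q^-r} with r = - m *)
      let r := - m in
      if u is p :: s then
        let l := last p s in
        - << rcons (rcons (belast p s) (l.1, (0, l.2.2 - r))) (1%N, (1, r)) >>
      else - << [:: (1%N, (1, r))] >>
  end.

(* (id (x) S) o (f (x) id) *)
Definition id_S_comp (f : symb -> {malg rat[(symb * symb)%type]}) :
    {malg rat[(symb * omega)%type]} -> {malg rat[(symb * symb)%type]} :=
  lext (fun p : symb * omega =>
    lext (fun cw : symb * symb => tens << cw.1 >> (S_symb cw.2 p.2)) (f p.1)).

Definition Const (u : symb) : {malg rat[(symb * symb)%type]} :=
  if z_free u then << (u, [::]) >> else 0.

Fixpoint phi_rec (n : nat) (u : symb) : {malg rat[(symb * symb)%type]} :=
  (if n is n'.+1 then id_S_comp (phi_rec n') (partial u) else 0) + Const u.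

(* [partial] lowers the weight by one and vanishes in weight 0. *)
Definition phi (u : symb) : {malg rat[(symb * symb)%type]} :=
  phi_rec (weight u) u.

(* F(k; n), for the symbol with arguments q^n_i, or z q^n_d for i = d; it
   gives both pi and pi_z. *)
Definition F (u : symb) : Qw :=
  \prod_(p <- u)
    \sum_(s < (p.1 - `|p.2.2|).+1) 'C(p.1 - `|p.2.2|, s)%:R *: b (p.1 - s).

Definition pi : QL -> Qw := lext F.

Definition phi_pi (u : QL) : {malg rat[({fmonom nat} * {fmonom nat})%type]} :=
  tmap F F (lext phi u).

Definition in_G (u : symb) : bool :=
  in_Fn 0 u && ((u == [::]) || (last 0 [seq p.2 | p <- u] != (1, 0))).

Definition at_z1 : QL -> QL :=
  lext (fun u : symb =>
    << [seq (p.1, (0, p.2.2)) | p : nat * arg <- u] >>).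

(* The symmetric algebra of Q<B>^0 is the polynomial ring over Q with one
   variable per admissible word. *)
Notation Sym := {malg rat[{cmonom {w : {fmonom nat} | adm w}}]}.

Definition sym_word (w : {fmonom nat}) : Sym :=
  if insub w is Some a then << ucm (a : {w : {fmonom nat} | adm w}) >> else 0.

Definition sym_of : Qw -> Sym := lext sym_word.

Definition m_odot : {malg rat[({fmonom nat} * {fmonom nat})%type]} -> Sym :=
  lext (fun p : {fmonom nat} * {fmonom nat} => sym_word p.1 * sym_word p.2).

Definition I_CF_gen (x : Sym) : Prop :=
  x = sym_of 1 - 1 \/
  exists2 u : QL, supported in_G u &
    x = m_odot (tmap (fun w => << w >>) (fun w => reg << w >>) (phi_pi u))
        - sym_of (pi (at_z1 u)).

Definition ideal_generated (R : comNzRingType) (X : R -> Prop) (x : R) : Prop :=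
  exists2 s : seq (R * R), (forall p, p \in s -> X p.2) &
    x = \sum_(p <- s) p.1 * p.2.

Definition I_CF_alg : Sym -> Prop := ideal_generated I_CF_gen.

Definition I_CF (u : Qw) : Prop := supported adm u /\ I_CF_alg (sym_of u).

(* For k = ({a}^{d_1-1}, c_1 + a, ..., {a}^{d_r-1}, c_r + a), [blocks a k] is
   [:: (c_1, d_1); ...; (c_r, d_r)]; n counts the letters a read so far in the
   current block. *)
Fixpoint blocks_rec (a n : nat) (k : seq nat) : seq (nat * nat) :=
  match k with
  | [::] => [::]
  | x :: k' => if x == a then blocks_rec a n.+1 k'
               else (x - a, n.+1)%N :: blocks_rec a 0 k'
  end.

Definition blocks (a : nat) : seq nat -> seq (nat * nat) := blocks_rec a 0.

Definition unblocks (a : nat) (s : seq (nat * nat)) : seq nat :=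
  flatten [seq rcons (nseq p.2.-1 a) (p.1 + a)%N | p <- s].

Definition dual (a : nat) (k : seq nat) : seq nat :=
  unblocks a [seq (p.2, p.1) | p <- rev (blocks a k)].

Lemma blocks_recK a n k :
  all (leq a) k -> (n == 0%N) || (k != [::]) -> last a.+1 k != a ->
  unblocks a (blocks_rec a n k) = nseq n a ++ k.
Proof.
elim: k n => [|x k IHk] n /=; first by rewrite orbF => _ /eqP -> .
case/andP=> le_ax le_ak _ lst; case: eqVneq => [x_a | ne_xa].
  rewrite IHk //=; last 2 first.
  - by case: k lst {IHk le_ak} => //=; rewrite x_a eqxx.
  - by case: k lst {IHk le_ak} => //= _; rewrite neq_ltn ltnSn orbT.
  by rewrite x_a; elim: (n) => //= n' <-.
rewrite /unblocks /= -/(unblocks _ _) IHk //=; last first.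
  by case: k lst {IHk le_ak} => //= _; rewrite neq_ltn ltnSn orbT.
by rewrite subnK // -cats1 -catA.
Qed.

Lemma blocksK a k :
  all (leq a) k -> last a.+1 k != a -> unblocks a (blocks a k) = k.
Proof. by move=> *; rewrite [LHS]blocks_recK. Qed.

Lemma unblocksK a s : all (fun p => (0 < p.1)%N && (0 < p.2)%N) s ->
  blocks a (unblocks a s) = s.
Proof.
have rec n m l : blocks_rec a n (nseq m a ++ l) = blocks_rec a (n + m) l.
  by elim: m n => [|m IHm] n /=; rewrite ?addn0 // eqxx IHm addSnnS.
elim: s => [|[c d] s IHs] //= /andP[/andP[c0 d0] s0].
rewrite /unblocks /blocks /= cat_rcons rec /= -/(unblocks _ _).
by rewrite -[X in _ == X]add0n eqn_add2r eqn0Ngt c0 /= addnK add0n prednK // -/(blocks _ _) IHs.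
Qed.

Definition Ind_BZ (k : seq nat) : bool := all (leq 1) k && (2 <= last 2 k)%N.
Definition dual_BZ : seq nat -> seq nat := dual 1.

Definition dual_SZ : seq nat -> seq nat := dual 0.

Definition F_BZ (k : seq nat) : Qw := \prod_(i <- k) (b i + b i.-1).

Definition V_BZ (v : Qw) : Prop :=
  exists2 c : {malg rat[seq nat]}, supported Ind_BZ c & v = lext F_BZ c.

(* A linear map on Q<B> with the prescribed values on the F_BZ k, which are
   linearly independent; only its restriction to V_BZ is meaningful. *)
Definition tau_BZ : {linear Qw -> Qw} :=
  epsilon (inhabits (GRing.null_fun Qw : {linear Qw -> Qw}))
    (fun t : {linear Qw -> Qw} =>
       forall k, Ind_BZ k -> t (F_BZ k) = F_BZ (dual_BZ k)).

(* The algebra morphism b_n |-> beta n maps b_n + b_{n-1} to b_n for n >= 1. *)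
Fixpoint beta (n : nat) : Qw := if n is m.+1 then b n - beta m else 0.

Lemma tau_BZ_F k : Ind_BZ k -> tau_BZ (F_BZ k) = F_BZ (dual_BZ k).
Proof.
move: k; pose P (t : {linear Qw -> Qw}) :=
  forall k, Ind_BZ k -> t (F_BZ k) = F_BZ (dual_BZ k).
suff: exists t, P t by move=> exP; exact: (epsilon_spec _ P exP).
pose psi : {linear Qw -> Qw} := lext (fun w : {fmonom nat} => \prod_(i <- w) beta i).
pose t : {linear Qw -> Qw} := lext (fun w : {fmonom nat} => F_BZ (dual_BZ w)).
have bw c i (w : {fmonom nat}) :
    b i * << c *g w >> = << c *g FMonom (i :: w) >>.
  by rewrite malgM_def fgmulUU mul1r; congr mkmalgU; exact: fmmulE.
have psi_b i u : psi (b i * u) = beta i * psi u.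
  rewrite (monalgE u) mulr_sumr !linear_sum mulr_sumr; apply: eq_bigr => w _.
  by rewrite bw /psi /= !lextZU big_cons malg_scalerAr.
have psiF l : all (leq 1) l -> psi (F_BZ l) = word l.
  elim: l => [|i l IHl] /=.
    have one : 1 = << FMonom [::] >> :> Qw by congr mkmalgU; exact: fmoneE.
    by rewrite /F_BZ big_nil one /psi /= lextU big_nil.
  case/andP=> i0 l0; rewrite /F_BZ big_cons mulrDl linearD /= !psi_b -mulrDl.
  by case: i i0 => //= i _; rewrite subrK -/(F_BZ _) IHl // bw.
exists (t \o psi) => k /andP[k0 _].
by rewrite /= psiF // /word lextU.
Qed.

Definition V_BZ_tens (t : {malg rat[({fmonom nat} * {fmonom nat})%type]}) : Prop :=
  exists2 s : seq (Qw * Qw), (forall p, p \in s -> V_BZ p.1) &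
    t = \sum_(p <- s) tens p.1 p.2.

Definition tau_BZ_id :
    {malg rat[({fmonom nat} * {fmonom nat})%type]} ->
    {malg rat[({fmonom nat} * {fmonom nat})%type]} :=
  tmap (fun w => tau_BZ << w >>) (fun w => << w >>).

Definition tau_SZ : Qw -> Qw :=
  lext (fun w : {fmonom nat} => word (dual_SZ w)).

Definition I_SZ_dual (v : Qw) : Prop :=
  exists2 u : Qw, supported adm u & v = u - tau_SZ u.

(* eps_i is the i-th entry of e, and eps_{d+1} is the default value [false]. *)
Definition Theta_symb (k : seq nat) (e : seq bool) : symb :=
  [seq let ei : int := nth false e i in
       let ei1 : int := nth false e i.+1 in
       (nth 0%N k i, (ei - ei1, (nth 0%N k i)%:Z - 1 + ei1))
  | i <- iota 0 (size k)].

Definition Theta (k : seq nat) : QL :=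
  \sum_(e : (size k).-tuple bool)
    (-1) ^+ (\sum_(x <- e) x)%N *: << Theta_symb k e >>.

(* Main.v *)
Require Import Defs.
From HB Require Import structures.
From mathcomp Require Import all_boot all_order all_algebra.
From mathcomp Require Import finmap monalg.
From mathcomp Require Import zify ring.
From Stdlib Require Import ClassicalEpsilon.
Set Implicit Arguments.
Unset Strict Implicit.
Unset Printing Implicit Defensive.
Import Order.TTheory GRing.Theory Num.Theory.
Local Open Scope ring_scope.

(** The symbol L_k(x) stands for the series over 0 < m_1 < ... < m_d of the
products of x_i^m_i / (1 - q^m_i)^k_i.  Summing over the signs turns Theta(k)
into the series with general term
[prod_i q^((k_i - 1) m_i) / (1 - q^m_i)^k_i
         * (1 - z^(m_i - m_(i-1)) q^m_(i-1)),    m_0 = 0,]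
and two values of z matter.

At z = 1 the factor of index 1 vanishes ([at_z1_Theta]), so the confluence
relation says that phi_pi(Theta(k)) evaluates to 0 modulo I_CF.  At z = q the
factor of index i is 1 - q^m_i and cancels one denominator, so that the series
becomes the one of the word b_(k_1 - 1) ... b_(k_d - 1)
([pi_at_z1_zq_Theta]); every word of Q<B>^0 has this form, and subtracting 1
from the entries turns the BZ dual into the SZ dual ([dual_BZ_SZ]).

The first value gives the BZ duality modulo I_CF ([BZ_duality]).  Indeed
phi_pi(Theta(k)) is F_BZ(k) (x) 1 plus terms whose left factor has smaller
weight ([phi_pi_Theta]).  Subtracting the relation of the dual index from that
of k, and using that the two elements are exchanged by tau_BZ, one gets
F_BZ(k) - F_BZ(dual k), plus multiples of the same differences in smaller
weight: an induction on the weight applies.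

The second value gives the SZ duality ([SZ_duality]).  The substitution
z -> zq in Theta(k) stays inside F^0, and phi commutes with it, acting on the
right factor only ([phi_zq]).  It multiplies the general term of the right
factor by q^m_d, and since Theta(k) also lies in F^(-1), the right factors of
phi(Theta(k)) only have last entries (k, z q^n) with 0 <= n < k
([phi_rec_last]), for which this multiplication is induced by a linear map
[raise] of Q<B>.  Hence phi_pi(Theta(k)(zq)) is the image of phi_pi(Theta(k))
under id (x) raise ([phi_pi_zq]), and it inherits the symmetry under tau_BZ.
As tau_BZ is trivial modulo I_CF, the confluence relations of Theta(k)(zq) and
Theta(dual k)(zq) have the same left hand side modulo I_CF, and the difference
of their right hand sides is b_w - b_(dual w) for the word w = k - 1. *)

(** * Linear maps on free modules *)

(** The variant of [supported] for conditions that are not decidable. *)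
Definition carried (K : choiceType) (Q : K -> Prop) (u : {malg rat[K]}) : Prop :=
  forall k, k \in msupp u -> Q k.

Lemma carriedW (K : choiceType) (Q Q' : K -> Prop) (u : {malg rat[K]}) :
  (forall k, Q k -> Q' k) -> carried Q u -> carried Q' u.
Proof. by move=> QQ' Qu k /Qu/QQ'. Qed.

Lemma carried0 (K : choiceType) (Q : K -> Prop) : carried Q 0.
Proof. by move=> k; rewrite msupp0 in_fset0. Qed.

Lemma carriedD (K : choiceType) (Q : K -> Prop) (u v : {malg rat[K]}) :
  carried Q u -> carried Q v -> carried Q (u + v).
Proof.
by move=> Qu Qv k /(fsubsetP (msuppD_le u v)); rewrite in_fsetU => /orP[/Qu|/Qv].
Qed.

Lemma carriedZ (K : choiceType) (Q : K -> Prop) (c : rat) (u : {malg rat[K]}) :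
  carried Q u -> carried Q (c *: u).
Proof. by move=> Qu k /(fsubsetP (msuppZ_le c u))/Qu. Qed.

Lemma carriedN (K : choiceType) (Q : K -> Prop) (u : {malg rat[K]}) :
  carried Q u -> carried Q (- u).
Proof. by move=> Qu k; rewrite msuppN => /Qu. Qed.

Lemma carriedU (K : choiceType) (Q : K -> Prop) (k : K) :
  Q k -> carried Q << k >>.
Proof. by move=> Qk k' /(fsubsetP msuppU_le); rewrite in_fset1 => /eqP->. Qed.

Lemma carried_sum (K : choiceType) (Q : K -> Prop) (I : Type) (r : seq I)
    (P : pred I) (F : I -> {malg rat[K]}) :
  (forall i, P i -> carried Q (F i)) -> carried Q (\sum_(i <- r | P i) F i).
Proof.
by move=> QF; apply: big_ind; [exact: carried0 | exact: carriedD | exact: QF].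
Qed.

Lemma lext_closed (K : choiceType) (V : lmodType rat) (P : V -> Prop)
    (f : K -> V) (u : {malg rat[K]}) :
  P 0 -> (forall x y, P x -> P y -> P (x + y)) ->
  (forall c x, P x -> P (c *: x)) ->
  carried (fun k => P (f k)) u -> P (lext f u).
Proof.
move=> P0 PD PZ Pf; rewrite /lext big_seq; apply: big_ind => // k /Pf.
exact: PZ.
Qed.

Lemma carried_lext (K L : choiceType) (Q : L -> Prop) (f : K -> {malg rat[L]})
    (u : {malg rat[K]}) :
  carried (fun k => carried Q (f k)) u -> carried Q (lext f u).
Proof.
apply: lext_closed; [exact: carried0 | exact: carriedD | exact: carriedZ].
Qed.

Lemma lextB (K : choiceType) (V : lmodType rat) (f g : K -> V) u :
  lext f u - lext g u = lext (fun k => f k - g k) u.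
Proof. by rewrite /lext -sumrB; apply: eq_bigr => k _; rewrite scalerBr. Qed.

Lemma eq_lext (K : choiceType) (V : lmodType rat) (f g : K -> V)
    (u : {malg rat[K]}) :
  carried (fun k => f k = g k) u -> lext f u = lext g u.
Proof. by move=> fg; rewrite /lext; apply: eq_big_seq => k /fg ->. Qed.

Lemma linear_lext (K : choiceType) (V W : lmodType rat) (L : {linear V -> W})
    (f : K -> V) (u : {malg rat[K]}) :
  L (lext f u) = lext (fun k => L (f k)) u.
Proof. by rewrite /lext linear_sum; apply: eq_bigr => k _; rewrite linearZ. Qed.

Lemma lext_basis (K : choiceType) (u : {malg rat[K]}) :
  lext (fun k => << k >>) u = u.
Proof.
rewrite [RHS]monalgE /lext; apply: eq_bigr => k _.
by apply/malgP => k'; rewrite mcoeffZ !mcoeffU mulrnAr mulr1.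
Qed.

Lemma linear_basisE (K : choiceType) (V : lmodType rat)
    (L : {linear {malg rat[K]} -> V}) (u : {malg rat[K]}) :
  L u = lext (fun k => L << k >>) u.
Proof. by rewrite -linear_lext lext_basis. Qed.

Lemma tens_is_linear (K L : choiceType) (u : {malg rat[K]}) :
  linear (fun v : {malg rat[L]} => tens u v).
Proof.
move=> c v w; rewrite /tens /lext scaler_sumr -big_split /=; apply: eq_bigr.
by move=> k _; rewrite -/(lext _ _) linearP scalerDr scalerA mulrC -scalerA.
Qed.

HB.instance Definition _ (K L : choiceType) (u : {malg rat[K]}) :=
  GRing.isLinear.Build rat {malg rat[L]} {malg rat[(K * L)%type]} *:%R
    (tens u) (tens_is_linear u).

Lemma tensUl (K L : choiceType) (k : K) (v : {malg rat[L]}) :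
  tens << k >> v = lext (fun l => << (k, l) >>) v.
Proof. by rewrite /tens lextU. Qed.

Lemma tensUU (K L : choiceType) (k : K) (l : L) :
  tens << k >> << l >> = << (k, l) >>.
Proof. by rewrite tensUl lextU. Qed.

Lemma carried_tens (K L : choiceType) (Q : K * L -> Prop) (u : {malg rat[K]})
    (v : {malg rat[L]}) :
  (forall k l, k \in msupp u -> l \in msupp v -> Q (k, l)) ->
  carried Q (tens u v).
Proof.
move=> Qkl; apply: carried_lext => k ku; apply: carried_lext => l lv.
by apply: carriedU; apply: Qkl.
Qed.

Lemma linear_tens (K L : choiceType) (V : lmodType rat)
    (M : {linear {malg rat[(K * L)%type]} -> V}) (u : {malg rat[K]})
    (v : {malg rat[L]}) :
  M (tens u v) = lext (fun k => lext (fun l => M << (k, l) >>) v) u.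
Proof.
by rewrite linear_lext; apply: eq_lext => k _; rewrite linear_lext.
Qed.

Lemma tens_lextl (K K' L : choiceType) (f : K -> {malg rat[K']})
    (u : {malg rat[K]}) (v : {malg rat[L]}) :
  tens (lext f u) v = lext (fun k => tens (f k) v) u.
Proof. exact: linear_lext. Qed.

HB.instance Definition _ (K L K' L' : choiceType) (f : K -> {malg rat[K']})
    (g : L -> {malg rat[L']}) :=
  GRing.Linear.copy (tmap f g)
    (lext (fun p : K * L => tens (f p.1) (g p.2))).

Lemma tmapU (K L K' L' : choiceType) (f : K -> {malg rat[K']})
    (g : L -> {malg rat[L']}) k l : tmap f g << (k, l) >> = tens (f k) (g l).
Proof. exact: lextU. Qed.

Lemma tmapE (K L K' L' : choiceType) (f : K -> {malg rat[K']})
    (g : L -> {malg rat[L']}) (u : {malg rat[K]}) (v : {malg rat[L]}) :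
  tmap f g (tens u v) = tens (lext f u) (lext g v).
Proof.
rewrite linear_tens tens_lextl; apply: eq_lext => k _.
by rewrite linear_lext; apply: eq_lext => l _; rewrite [LHS]lextU.
Qed.

(** * Symbols and their standard paths *)

Notation word_pairs := {malg rat[({fmonom nat} * {fmonom nat})%type]}.

Notation entry := (nat * arg)%type.
Notation entry0 := ((0%N, 0) : entry).

Definition zq_entry (p : entry) : entry := (p.1, (p.2.1, p.2.2 + p.2.1)).
Definition zq (u : symb) : symb := [seq zq_entry p | p <- u].

Definition zdeg (u : symb) : int := \sum_(p <- u) p.2.1.

(** The conditions on the weights and on the powers of z in the definition of the
formal symbols: the moves of the standard path and the merging of neighbours
preserve them, and with them the alternation of z and 1/z. *)
Fixpoint wf (u : symb) : bool :=
  if u is p :: u' then [&& (0 < p.1)%N, 0 <= zdeg u <= 1 & wf u'] else true.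

Lemma zdeg_cons p u : zdeg (p :: u) = p.2.1 + zdeg u.
Proof. by rewrite /zdeg big_cons. Qed.

Lemma zdeg_nil : zdeg [::] = 0.
Proof. by rewrite /zdeg big_nil. Qed.

Lemma zdeg_cat u v : zdeg (u ++ v) = zdeg u + zdeg v.
Proof. by rewrite /zdeg big_cat. Qed.

Lemma wf_suffix u v : wf (u ++ v) -> wf v.
Proof. by elim: u => //= p u IHu /and3P[_ _ /IHu]. Qed.

Lemma wf_zdeg u : wf u -> 0 <= zdeg u <= 1.
Proof. by case: u => [|p u] /=; [rewrite zdeg_nil | case/and3P]. Qed.

(** All three kinds of terms of D keep the product of the arguments in the suffix
where they modify it. *)
Lemma wf_replace u v v' :
  zdeg v = zdeg v' -> wf v' -> wf (u ++ v) -> wf (u ++ v').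
Proof.
move=> Dv wv'; elim: u => //= p u IHu /and3P[-> + /IHu->].
by rewrite !zdeg_cons !zdeg_cat Dv andbT.
Qed.

Lemma wf_entry u p : wf u -> p \in u -> (0 < p.1)%N /\ -1 <= p.2.1 <= 1.
Proof.
elim: u => //= p' u IHu /and3P[p0]; rewrite zdeg_cons => d wu.
rewrite in_cons => /orP[/eqP-> | /(IHu wu)//]; split=> //.
by have := wf_zdeg wu; lia.
Qed.

Lemma wf_map (f : entry -> entry) u :
  (forall p, (f p).1 = p.1 /\ (f p).2.1 = p.2.1) -> wf (map f u) = wf u.
Proof.
move=> Df; elim: u => //= p u ->; rewrite !zdeg_cons (Df p).1 (Df p).2.
suff -> : zdeg (map f u) = zdeg u by [].
by rewrite /zdeg big_map; apply: eq_bigr => i _; rewrite (Df i).2.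
Qed.

Lemma weight_cat u v : weight (u ++ v) = (weight u + weight v)%N.
Proof. by rewrite /weight big_cat. Qed.

Lemma weight_cons p u : weight (p :: u) = (p.1 + weight u)%N.
Proof. by rewrite /weight big_cons. Qed.

(** The words on the standard path of u: s lists the positions moved so far. *)
Definition moved (s : seq nat) (u : symb) : symb :=
  mkseq (fun i => let p := nth entry0 u i in if i \in s then zq_entry p else p) (size u).

Lemma size_moved s u : size (moved s u) = size u.
Proof. exact: size_mkseq. Qed.

Lemma nth_moved s u i : nth entry0 (moved s u) i =
  if i \in s then zq_entry (nth entry0 u i) else nth entry0 u i.
Proof.
have [lt_iu | le_ui] := ltnP i (size u); first by rewrite nth_mkseq.
by rewrite !nth_default ?size_moved //; case: ifP.
Qed.

Lemma moved0 u : moved [::] u = u.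
Proof.
by apply: (@eq_from_nth _ entry0); rewrite ?size_moved // => i _; rewrite nth_moved.
Qed.

Lemma size_qshift s u j : (j < size u)%N -> size (qshift s u j) = size u.
Proof. by move=> ju; rewrite size_set_nth (maxn_idPr ju). Qed.

Lemma moved_rcons s u j : (j < size u)%N -> j \notin s ->
  moved (rcons s j) u = qshift (sarg u j).1 (moved s u) j.
Proof.
move=> ju jns; apply: (@eq_from_nth _ entry0); first by rewrite size_qshift ?size_moved.
rewrite size_moved => i iu.
rewrite nth_moved mem_rcons in_cons nth_set_nth /= nth_moved.
case: eqVneq => //= ->; rewrite /dep /sarg nth_moved (negPf jns) /zq_entry.
by case: (nth _ _ _) => k [h m] /=; congr (_, (_, _)); rewrite addr0.
Qed.

Lemma sarg_moved1 s u j : (sarg (moved s u) j).1 = (sarg u j).1.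
Proof. by rewrite /sarg nth_moved; case: ifP. Qed.

Lemma wf_moved s u : wf (moved s u) = wf u.
Proof.
pose f (i : nat) (p : entry) := if i \in s then zq_entry p else p.
suff gen v n : wf (mkseq (fun i => f (n + i)%N (nth entry0 v i)) (size v)) = wf v /\
    zdeg (mkseq (fun i => f (n + i)%N (nth entry0 v i)) (size v)) = zdeg v.
  by case: (gen u 0%N).
elim: v n => //= p v IHv n; have Df i q : (f i q).1 = q.1 /\ (f i q).2.1 = q.2.1.
  by rewrite /f; case: ifP.
rewrite /mkseq /=.
have -> : [seq f (n + i)%N (nth entry0 (p :: v) i) | i <- iota 1 (size v)] =
   mkseq (fun i => f (n.+1 + i)%N (nth entry0 v i)) (size v).
  rewrite -[1%N]addn0 iotaDl -map_comp; apply: eq_map => i /=.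
  by rewrite add1n addnS.
have [-> Dz] := IHv n.+1.
rewrite !zdeg_cons Dz !(Df _ _).1 !(Df _ _).2 //.
Qed.

Lemma std_order_uniq u : uniq (std_order u).
Proof. by rewrite sort_uniq filter_uniq ?iota_uniq. Qed.

Lemma mem_std_order u i :
  (i \in std_order u) = ((sarg u i).1 != 0) && (i < size u)%N.
Proof. by rewrite mem_sort mem_filter mem_iota. Qed.

(** When position j moves, its level separates the moved positions from the
others. *)
Lemma std_order_split u s1 j s2 : std_order u = s1 ++ j :: s2 ->
  (forall i, i \in s1 -> level (sarg u i) <= level (sarg u j)) /\
  (forall i, (i < size u)%N -> (sarg u i).1 != 0 -> i \notin s1 ->
     level (sarg u j) <= level (sarg u i)).
Proof.
move=> Ds; pose le i j :=
  (level (sarg u i) < level (sarg u j)) ||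
  (level (sarg u i) == level (sarg u j)) && (j <= i)%N.
have le_tr : transitive le by move=> x y z; rewrite /le; lia.
have: sorted le (std_order u).
  by apply: sort_sorted => x y; rewrite /le; lia.
rewrite (sorted_pairwise le_tr) Ds pairwise_cat allrel_consr /=.
case/and3P=> /andP[/allP s1j _] _ /andP[/allP js2 _]; split=> [i /s1j | i iu hi s1i].
  by rewrite /le; lia.
have: i \in std_order u by rewrite mem_std_order hi.
rewrite Ds mem_cat (negbTE s1i) /= in_cons => /orP[/eqP-> // | /js2].
by rewrite /le; lia.
Qed.

Lemma nth_cat_size (v1 v2 : symb) p : nth entry0 (v1 ++ p :: v2) (size v1) = p.
Proof. by elim: v1. Qed.

Lemma cat_nth (v : symb) j : (j < size v)%N ->
  v = take j v ++ nth entry0 v j :: drop j.+1 v.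
Proof. by move=> jv; rewrite -drop_nth // cat_take_drop. Qed.

Lemma D_qshift (s : int) v j : s = 1 \/ s = -1 -> (j < size v)%N ->
  D v (qshift s v j) = if s == 1 then D_up v j else - D_up (qshift (-1) v j) j.
Proof.
move=> Ds jv; have Dq t : qshift t v j =
    take j v ++ (dep v j, sarg v j + (0, t)) :: drop j.+1 v.
  by rewrite /qshift set_nthE jv.
have neq t t' : t != t' -> qshift t v j == qshift t' v j = false.
  move=> ne; apply/negP=> /eqP /(congr1 (fun w => (sarg w j).2)).
  rewrite /sarg !nth_set_nth /= !eqxx /=.
  by move/addrI/eqP; rewrite (negPf ne).
have Df : find (fun p => p.1 != p.2) (zip v (qshift s v j)) = j.
  rewrite Dq {1}(cat_nth jv) zip_cat // find_cat /=.
  rewrite size_zip minnn (size_takel (ltnW jv)).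
  have -> : has (fun p => p.1 != p.2) (zip (take j v) (take j v)) = false.
    apply/hasPn; elim: (take j v) => //= a w IHw p.
    by rewrite in_cons => /orP[/eqP->|/IHw//]; rewrite /= eqxx.
  have -> : (nth entry0 v j != (dep v j, sarg v j + (0, s))).
    apply/eqP=> /(congr1 (fun p : entry => p.2.2)); rewrite /sarg /=.
    by case: Ds => ->; lia.
  by rewrite addn0.
rewrite /D Df; case: Ds => ->; first by rewrite eqxx.
by rewrite neq // eqxx.
Qed.

(** The contribution of the move of position j.  An argument q^m / z moves
downwards, and D is antisymmetric. *)
Definition D_step (v : symb) (j : nat) : {malg rat[(symb * omega)%type]} :=
  if (sarg v j).1 == 1 then D_up v j else - D_up (qshift (-1) v j) j.

Lemma sarg_z u j : wf u -> (sarg u j).1 != 0 -> (j < size u)%N ->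
  (sarg u j).1 = 1 \/ (sarg u j).1 = -1.
Proof.
move=> wu hj ju; have [_ /andP[]] := wf_entry wu (mem_nth entry0 ju).
by rewrite -/(sarg u j); move: hj; case: (sarg u j).1 => n; lia.
Qed.

Lemma partialE u : wf u ->
  partial u = \sum_(0 <= i < size (std_order u))
     D_step (moved (take i (std_order u)) u) (nth 0%N (std_order u) i).
Proof.
move=> wu.
pose F i := D_step (moved (take i (std_order u)) u) (nth 0%N (std_order u) i).
rewrite /partial /Std /=.
set f := (fun v j => _).
suff gen s1 s2 : std_order u = s1 ++ s2 ->
    \sum_(p <- zip (moved s1 u :: scanl f (moved s1 u) s2)
                   (scanl f (moved s1 u) s2)) D p.1 p.2 =
    \sum_(size s1 <= i < size (std_order u)) F i.
  by have := gen [::] (std_order u) erefl; rewrite moved0.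
elim: s2 s1 => [|j s2 IHs2] s1 Ds.
  by rewrite Ds cats0 big_nil big_geq.
have: j \in std_order u by rewrite Ds mem_cat mem_head orbT.
rewrite mem_std_order => /andP[hj ju].
have js1 : j \notin s1.
  by have := std_order_uniq u; rewrite Ds cat_uniq /= negb_or => /and4P[_ /andP[]].
have Df : f (moved s1 u) j = moved (rcons s1 j) u.
  by rewrite /f sarg_moved1 moved_rcons.
rewrite /= big_cons /= Df IHs2 ?cat_rcons // size_rcons [RHS]big_ltn; last first.
  by rewrite Ds size_cat /=; lia.
congr (_ + _); rewrite /F Ds take_size_cat // nth_cat ltnn subnn /=.
have := sarg_z wu hj ju; rewrite moved_rcons // /D_step sarg_moved1 => hz.
rewrite D_qshift ?size_moved //.
Qed.

(** * The terms of the difference operator *)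

(** The shape of the terms A of D, where the argument of p is merged into its left
neighbour, or dropped. *)
Definition merge_left (v1 : symb) (p : entry) (v2 w : symb) : Prop :=
  (v1 = [::] /\ w = v2) \/
  exists v p0, v1 = rcons v p0 /\ w = v ++ (p0.1, p0.2 + p.2) :: v2.

Lemma dep_cat v1 p v2 : dep (v1 ++ p :: v2) (size v1) = p.1.
Proof. by rewrite /dep nth_cat_size. Qed.

Lemma sarg_cat v1 p v2 : sarg (v1 ++ p :: v2) (size v1) = p.2.
Proof. by rewrite /sarg nth_cat_size. Qed.

Lemma set_nth_cat (v1 v2 : symb) p p' :
  set_nth entry0 (v1 ++ p :: v2) (size v1) p' = v1 ++ p' :: v2.
Proof. by elim: v1 => //= a v1 ->. Qed.

Lemma D_A_merge v1 p v2 :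
  merge_left v1 p v2 (D_A (v1 ++ p :: v2) (size v1)).
Proof.
case/lastP: v1 => [|v p0]; first by left.
right; exists v, p0; split=> //.
have := sarg_cat (rcons v p0) p v2; rewrite size_rcons /D_A => ->.
rewrite cat_rcons dep_cat sarg_cat take_size_cat //.
have -> : v ++ p0 :: p :: v2 = rcons (rcons v p0) p ++ v2 by rewrite !cat_rcons.
by rewrite drop_size_cat ?size_rcons.
Qed.

Lemma carried_D_B Q v1 p v2 :
  (forall p' v, v2 = p' :: v -> Q (v1 ++ (p'.1, p.2 + p'.2) :: v)) ->
  carried Q (D_B (v1 ++ p :: v2) (size v1)).
Proof.
move=> QB; rewrite /D_B size_cat /=; case: v2 QB => [|p' v] QB.
  by rewrite addn1 ltnn; apply: carried0.
rewrite /= !addnS !ltnS leq_addr; apply: carriedU.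
have Ds := sarg_cat (rcons v1 p) p' v; have Dd := dep_cat (rcons v1 p) p' v.
rewrite size_rcons cat_rcons in Ds Dd; rewrite Ds Dd sarg_cat take_size_cat //.
have -> : v1 ++ p :: p' :: v = rcons (rcons v1 p) p' ++ v by rewrite !cat_rcons.
by rewrite drop_size_cat ?size_rcons //; apply: QB.
Qed.

(** The terms of D with index e_0 lower k_j, or merge to the right if the argument
is in z q^Z, or to the left if it is in z^(-1) q^Z.  The terms with another
index only occur for k_j = 1. *)
Lemma carried_D_up (Q : symb * omega -> Prop) v1 p v2 :
  ((1 < p.1)%N -> Q (v1 ++ (p.1.-1, p.2) :: v2, None)) ->
  (forall w, (p.1 <= 1)%N -> merge_left v1 p v2 w ->
     if p.2.1 == 1 then Q (w, Some (- p.2.2))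
     else Q (w, Some p.2.2) /\ Q (w, None)) ->
  (forall p' v, (p.1 <= 1)%N -> v2 = p' :: v ->
     let w := v1 ++ (p'.1, p.2 + p'.2) :: v in
     if p.2.1 == 1 then Q (w, Some (- p.2.2)) /\ Q (w, None)
     else Q (w, Some p.2.2)) ->
  carried Q (D_up (v1 ++ p :: v2) (size v1)).
Proof.
move=> Qe QA QB; rewrite /D_up sarg_cat dep_cat; case: p => k [h m] /= in Qe QA QB *.
have [k1 | k1] := ltnP 1 k.
  by rewrite tensUU set_nth_cat; apply: carriedU; apply: Qe.
have {}QA := QA _ k1 (@D_A_merge v1 (k, (h, m)) v2); have {}QB p' v := QB p' v k1.
have tB e : (forall p' v, v2 = p' :: v -> Q (v1 ++ (p'.1, (h, m) + p'.2) :: v, e)) ->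
    carried Q (tens (D_B (v1 ++ (k, (h, m)) :: v2) (size v1)) << e >>).
  move=> Qe'; apply: carried_tens => w e' wB.
  move=> /(fsubsetP msuppU_le); rewrite in_fset1 => /eqP->; move: w wB.
  exact: (@carried_D_B (fun w => Q (w, e)) _ (k, (h, m))).
case: ifP => h1; rewrite h1 in QA QB; rewrite linearB /= ?tensUU.
  apply: carriedD; first by apply: carriedN; apply: carriedU.
  by apply: carriedD; [|apply: carriedN]; apply: tB => p' v /QB[].
have [QA1 QA2] := QA; apply: carriedD.
  by apply: carriedD; [|apply: carriedN]; apply: carriedU.
by apply: carriedN; apply: tB => p' v /QB.
Qed.

Lemma merge_left_wf v1 p v2 w :
  p.1 = 1%N -> wf (v1 ++ p :: v2) -> merge_left v1 p v2 w ->
  wf w /\ (weight w < weight (v1 ++ p :: v2))%N.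
Proof.
move=> k1 wv [[Dv1 ->] | [v [p0 [Dv1 ->]]]].
  rewrite Dv1 in wv *; split; last by rewrite weight_cons k1; lia.
  exact: (@wf_suffix [:: p]).
rewrite Dv1 cat_rcons in wv *; have := wf_suffix wv => /= /and3P[p00 d /and3P[_ _ wv2]].
split; last by rewrite !weight_cat !weight_cons /= k1; lia.
apply: wf_replace wv; first by rewrite !zdeg_cons /=; lia.
by move: d; rewrite /= p00 wv2 !zdeg_cons /= addrA andbT.
Qed.

Lemma merge_right_wf v1 p p' v2 :
  p.1 = 1%N -> wf (v1 ++ p :: p' :: v2) ->
  let w := v1 ++ (p'.1, p.2 + p'.2) :: v2 in
  wf w /\ (weight w < weight (v1 ++ p :: p' :: v2))%N.
Proof.
move=> k1 wv w; have := wf_suffix wv => /= /and3P[_ d /and3P[p'0 _ wv2]].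
split; last by rewrite !weight_cat !weight_cons /= k1; lia.
apply: wf_replace wv; first by rewrite !zdeg_cons /=; lia.
by move: d; rewrite /= p'0 wv2 !zdeg_cons /= addrA andbT.
Qed.

Lemma lower_wf v1 p v2 : (1 < p.1)%N -> wf (v1 ++ p :: v2) ->
  let w := v1 ++ (p.1.-1, p.2) :: v2 in
  wf w /\ (weight w < weight (v1 ++ p :: v2))%N.
Proof.
move=> k1 wv w; have := wf_suffix wv => /= /and3P[_ d wv2].
split; last by rewrite !weight_cat !weight_cons /=; lia.
apply: wf_replace wv; first by rewrite !zdeg_cons.
by move: d; rewrite /= wv2 !zdeg_cons /= => ->; rewrite !andbT; lia.
Qed.

Lemma D_up_wf v j : wf v -> (j < size v)%N ->
  carried (fun we => wf we.1 /\ (weight we.1 < weight v)%N) (D_up v j).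
Proof.
move=> + jv; rewrite (cat_nth jv); set p := nth _ _ _.
move: (take j v) (size_takel (ltnW jv)) (drop _ _) => v1 <- v2 wv.
have p0 : (0 < p.1)%N by have /= /andP[] := wf_suffix wv.
apply: carried_D_up => [k1 | w k1 | p' v' k1 Dv2] /=; first exact: lower_wf.
  have {}k1 : p.1 = 1%N by lia.
  by move/(merge_left_wf k1 wv); case: ifP.
have {}k1 : p.1 = 1%N by lia.
by rewrite Dv2 in wv *; have := merge_right_wf k1 wv; case: ifP.
Qed.

Lemma qshift_cat s v1 p v2 :
  qshift s (v1 ++ p :: v2) (size v1) = v1 ++ (p.1, p.2 + (0, s)) :: v2.
Proof. by rewrite /qshift dep_cat sarg_cat set_nth_cat. Qed.

Lemma qshift_wf s v j : (j < size v)%N ->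
  wf (qshift s v j) = wf v /\ weight (qshift s v j) = weight v.
Proof.
move=> jv; rewrite (cat_nth jv); set p := nth _ _ _.
move: (take j v) (size_takel (ltnW jv)) (drop _ _) => v1 <- v2.
rewrite qshift_cat; split; last by rewrite !weight_cat !weight_cons.
have D2 : zdeg ((p.1, p.2 + (0, s)) :: v2) = zdeg (p :: v2).
  by rewrite !zdeg_cons /= addr0.
by apply/idP/idP=> wv; apply: (wf_replace _ _ wv) => //; have := wf_suffix wv;
   rewrite /= D2.
Qed.

Lemma D_step_wf v j : wf v -> (j < size v)%N ->
  carried (fun we => wf we.1 /\ (weight we.1 < weight v)%N) (D_step v j).
Proof.
move=> wv jv; have [wq eq] := qshift_wf (-1) jv.
rewrite /D_step; case: ifP => _; first exact: D_up_wf.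
by apply: carriedN; rewrite -eq; apply: D_up_wf; rewrite ?wq ?size_qshift.
Qed.

Lemma weight_moved s u : weight (moved s u) = weight u.
Proof.
rewrite /weight (big_nth entry0) size_moved [RHS](big_nth entry0).
by apply: eq_bigr => i _; rewrite nth_moved; case: ifP.
Qed.

Lemma carried_partial (Q : symb * omega -> Prop) u : wf u ->
  (forall s1 j s2, std_order u = s1 ++ j :: s2 -> (j < size u)%N -> j \notin s1 ->
     (sarg u j).1 = 1 \/ (sarg u j).1 = -1 -> carried Q (D_step (moved s1 u) j)) ->
  carried Q (partial u).
Proof.
move=> wu Qs; rewrite partialE // big_mkord; apply: carried_sum => -[i /= iu] _.
have Ds : std_order u = take i (std_order u) ++ nth 0%N (std_order u) i ::
    drop i.+1 (std_order u) by rewrite -drop_nth // cat_take_drop.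
have := std_order_uniq u; rewrite {1}Ds cat_uniq /= negb_or => /and4P[_ /andP[js1 _] _ _].
have := mem_nth 0%N iu; rewrite mem_std_order => /andP[hj ju].
exact: (Qs _ _ _ Ds ju js1 (sarg_z wu hj ju)).
Qed.

Lemma partial_wf u : wf u ->
  carried (fun we => wf we.1 /\ (weight we.1 < weight u)%N) (partial u).
Proof.
move=> wu; apply: carried_partial => // s1 j s2 _ ju _ _.
by rewrite -(weight_moved s1 u); apply: D_step_wf; rewrite ?wf_moved ?size_moved.
Qed.

(** * The exponents of q in the last argument *)

Definition in_range (n : int) (p : entry) : bool := 0 <= p.2.2 - n * p.2.1 <= p.1%:Z.

(** Membership in F^n, with [wf] for the condition on the formal symbols. *)
Definition tame (n : int) (u : symb) : bool := wf u && all (in_range n) u.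

(** The entries that occur on the path of a tame symbol when an entry of level r
moves: those with z are either unmoved and of level at least r, or moved and of
level at most r. *)
Definition on_path (n r : int) (p : entry) : bool :=
  let: (k, (h, m)) := p in
  (0 < k)%N && [|| (h == 0) && (0 <= m <= k%:Z),
    (h == 1) && ((r <= m) && (n <= m <= n + k%:Z)
                 || (m - 1 <= r) && (n <= m - 1 <= n + k%:Z)) |
    (h == -1) && ((r <= 1 - m) && (0 <= m + n <= k%:Z)
                 || (- m <= r) && (0 <= m + 1 + n <= k%:Z))].

(** Before the levels exceed n the path remains in F^n; from then on every entry of
level n has been moved, and the path is in F^(n+1). *)
Lemma on_path_in_range n r t p :
  (r <= n /\ t = n) \/ (n < r /\ t = n + 1) -> on_path n r p -> in_range t p.
Proof.
case: p => k [h m]; rewrite /on_path /in_range /= => Dt /andP[k0].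
by case/or3P=> /andP[/eqP->]; case: Dt => -[rn ->]; lia.
Qed.

Lemma moved_on_path n s u r : tame n u ->
  (forall i, i \in s -> level (sarg u i) <= r) ->
  (forall i, (i < size u)%N -> (sarg u i).1 != 0 -> i \notin s ->
     r <= level (sarg u i)) ->
  all (on_path n r) (moved s u).
Proof.
case/andP=> wu ru sr rs; apply/(all_nthP entry0) => i; rewrite size_moved => iu.
rewrite nth_moved; have := all_nthP entry0 ru i iu.
have [] := wf_entry wu (mem_nth entry0 iu); move: (sr i) (rs i iu).
rewrite /sarg; case: (nth entry0 u i) => k [h m] /=; rewrite /in_range /level /=.
move=> ssr srs k0 h1 rk; case: ifP => si; rewrite si /= in ssr srs.
  have {srs}/= := ssr isT; rewrite k0 /=.
  have h3 : h = 0 \/ h = 1 \/ h = -1 by lia.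
  by case: h3 => [|[|]] Dh; subst h; rewrite ?eqxx /=; lia.
have h3 : h = 0 \/ h = 1 \/ h = -1 by lia.
by case: h3 => [|[|]] Dh; subst h; rewrite /= k0 /=; move: srs => /=; lia.
Qed.

(** What is needed of a term of D created at level r on the path of an element of
F^n: its e_0 part is again in F^n or F^(n+1), according to r, and the other
indices are e_(q^-r), which requires k_j = 1 and hence r = n or r = n + 1. *)
Definition next_range (n r : int) (we : symb * omega) : Prop :=
  match we.2 with
  | None => forall t, (r <= n /\ t = n) \/ (n < r /\ t = n + 1) -> tame t we.1
  | Some m => m = - r /\ n <= r <= n + 1
  end.

Lemma D_up_range n r v1 p v2 :
  wf (v1 ++ p :: v2) -> all (on_path n r) (v1 ++ p :: v2) ->
  (p.2 = (1, r) /\ n <= r <= n + p.1%:Z) \/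
    (p.2 = (-1, - r) /\ n + 1 - p.1%:Z <= r <= n + 1) ->
  carried (next_range n r) (D_up (v1 ++ p :: v2) (size v1)).
Proof.
move=> wv; rewrite all_cat /= => /and3P[r1 rp r2] Dp.
have p0 : (0 < p.1)%N by have /= /and3P[] := wf_suffix wv.
apply: carried_D_up => [k1 | w k1 | p' v k1 Dv2].
- move=> t Dt /=; rewrite /tame (lower_wf k1 wv).1 /= all_cat /=.
  have rt := sub_all (fun p => @on_path_in_range n r t p Dt).
  rewrite (rt _ r1) (rt _ r2) andbT /=.
  case: p Dp k1 {wv rp p0} => k x /= Dp k1; rewrite /in_range /=.
  by case: Dp => -[-> /= ?]; lia.
- have {}k1 : p.1 = 1%N by lia.
  move=> Lw; have [ww _] := merge_left_wf k1 wv Lw.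
  case: Dp => -[Dp rr]; rewrite Dp /next_range /=; first by split=> //; lia.
  split; first by split=> //; lia.
  move=> t Dt; rewrite /tame ww /=.
  have rt := sub_all (fun p => @on_path_in_range n r t p Dt).
  case: Lw => [[_ ->] | [v [q [Dv1 ->]]]]; first exact: rt.
  move: r1; rewrite Dv1 all_rcons all_cat /= => /andP[rq rv].
  rewrite (rt _ rv) (rt _ r2) andbT /=.
  rewrite Dv1 cat_rcons in wv.
  have /= /and3P[_ d1 /and3P[_ _ wv2]] := wf_suffix wv.
  have := wf_zdeg wv2; rewrite !zdeg_cons Dp /= in d1 *.
  case: q rq {Dv1 wv ww} d1 => k [h m]; rewrite /on_path /in_range /=.
  move=> rq d1 d2; have {d1 d2} h01 : h = 0 \/ h = 1 by lia.
  by case: h01 => h01; subst h; rewrite /= in rq *; lia.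
have {}k1 : p.1 = 1%N by lia.
rewrite Dv2 in wv r2; have [/= ww _] := merge_right_wf k1 wv.
case: Dp => -[Dp rr]; rewrite /next_range /=; last by rewrite Dp; split=> //; lia.
rewrite Dp /= in ww *; split; first by split=> //; lia.
move=> t Dt; rewrite /tame ww /= all_cat /=.
have rt := sub_all (fun p => @on_path_in_range n r t p Dt).
case/andP: r2 => rp' r2; rewrite (rt _ r1) (rt _ r2) andbT /=.
have /= /and3P[_ d1 /and3P[_ _ wv']] := wf_suffix wv.
have := wf_zdeg wv'; rewrite !zdeg_cons Dp /= in d1 *.
case: p' rp' {Dv2 wv ww} d1 => k [h m].
rewrite /on_path /in_range /= => rq d1 d2.
have {d1 d2} h01 : h = 0 \/ h = -1 by lia.
by case: h01 => h01; subst h; rewrite /= in rq *; lia.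
Qed.

Lemma D_step_range n u s1 j s2 : tame n u ->
  std_order u = s1 ++ j :: s2 -> (j < size u)%N -> j \notin s1 ->
  (sarg u j).1 = 1 \/ (sarg u j).1 = -1 ->
  carried (next_range n (level (sarg u j))) (D_step (moved s1 u) j).
Proof.
move=> tu Ds ju js1 hj; have [le1 le2] := std_order_split Ds.
have wu : wf u by case/andP: tu.
have [p0 _] := wf_entry wu (mem_nth entry0 ju).
have := all_nthP entry0 (proj2 (andP tu)) j ju.
have Dp : nth entry0 u j = (dep u j, sarg u j) by rewrite /dep /sarg -surjective_pairing.
rewrite Dp /in_range /= => rj; rewrite Dp in p0; rewrite /D_step sarg_moved1.
case: hj => hj; rewrite hj /=.
  have jv : (j < size (moved s1 u))%N by rewrite size_moved.
  have := moved_on_path tu le1 le2; have: wf (moved s1 u) by rewrite wf_moved.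
  rewrite (cat_nth jv) nth_moved (negPf js1) Dp.
  move: (take j _) (size_takel (ltnW jv)) (drop _ _) => v1 D1 v2 wv rv.
  rewrite -[X in D_up _ X]D1; apply: D_up_range => //; left; rewrite /level hj /=.
  by move: rj hj; case: (sarg u j) => h m /= rj hj; rewrite hj in rj *; split=> //; lia.
have -> : qshift (-1) (moved s1 u) j = moved (rcons s1 j) u.
  by rewrite moved_rcons // hj.
have jv : (j < size (moved (rcons s1 j) u))%N by rewrite size_moved.
have: all (on_path n (level (sarg u j))) (moved (rcons s1 j) u).
  apply: moved_on_path => // i; rewrite mem_rcons in_cons.
    by case/orP=> [/eqP-> // | /le1].
  by rewrite negb_or => iu hi /andP[_ /(le2 i iu hi)].
have: wf (moved (rcons s1 j) u) by rewrite wf_moved.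
rewrite (cat_nth jv) nth_moved mem_rcons mem_head Dp.
move: (take j _) (size_takel (ltnW jv)) (drop _ _) => v1 D1 v2 wv rv.
rewrite -[X in D_up _ X]D1; apply: carriedN; apply: D_up_range => //; right.
rewrite /level hj /=.
move: rj hj; case: (sarg u j) => h m /= rj hj; rewrite hj in rj *.
by split; [congr (_, _) |]; lia.
Qed.

(** A class that contains the symbols obtained from F^0 and F^(-1) by a steps of
the e_0 part of the difference operator: the first step leads to F^0, and then
F^n leads to F^n and F^(n+1). *)
Definition in_stage (a : nat) (u : symb) : Prop :=
  if a is a'.+1 then exists2 n : nat, (n <= a')%N & tame n%:Z u
  else tame 0 u /\ tame (-1) u.

(** For a = 0, a move of level at most 0 gives e_0 terms in F^0 because u is in
F^0, and one of level at least 0 because u is in F^(-1). *)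
Lemma partial_stage a u : in_stage a u ->
  carried (fun we : symb * omega =>
    if we.2 is Some m then - a%:Z <= m <= 0 else in_stage a.+1 we.1) (partial u).
Proof.
move=> su; have wu : wf u by case: a su => [[/andP[]] | a [n _ /andP[]]].
apply: carried_partial => // s1 j s2 Ds ju js1 hj [w e].
case: a su => [[t0 t1] | a [n na tn]] we.
  have := D_step_range t0 Ds ju js1 hj we; have := D_step_range t1 Ds ju js1 hj we.
  rewrite /next_range /=; case: e {we} => [m [-> ?] [_ ?] | r1 r0]; first lia.
  exists 0%N => //; have [r | r] := leP (level (sarg u j)) 0.
    by apply: r0; left.
  by apply: r1; right; split=> //; lia.
have := D_step_range tn Ds ju js1 hj we.
rewrite /next_range /=; case: e {we} => [m [-> ?] | r]; first lia.
have [l | l] := leP (level (sarg u j)) n; first by exists n; [lia | apply: r; left].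
exists n.+1; first lia.
by apply: r; right; split=> //; lia.
Qed.

Lemma S_symb_None s p : S_symb (rcons s p) None = << rcons s (p.1.+1, p.2) >>.
Proof. by case: s => [|p' s] //=; rewrite last_rcons belast_rcons. Qed.

Lemma S_symb_Some s p m : S_symb (rcons s p) (Some m) =
  - << rcons (rcons s (p.1, (0, p.2.2 - - m))) (1%N, (1, - m)) >>.
Proof. by case: s => [|p' s] //=; rewrite last_rcons belast_rcons. Qed.

Lemma carried_id_S_comp f (t : {malg rat[(symb * omega)%type]})
    (Q : symb * symb -> Prop) :
  carried (fun we => carried (fun cw =>
    carried (fun w' => Q (cw.1, w')) (S_symb cw.2 we.2)) (f we.1)) t ->
  carried Q (id_S_comp f t).
Proof.
move=> Qt; apply: carried_lext => we /Qt Qwe; apply: carried_lext => cw /Qwe Qcw.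
by rewrite tensUl; apply: carried_lext => w' /Qcw; apply: carriedU.
Qed.

Lemma carried_Const (Q : symb * symb -> Prop) u :
  (z_free u -> Q (u, [::])) -> carried Q (Const u).
Proof.
by rewrite /Const; case: ifP => [_ /(_ isT)|_ _]; [apply: carriedU | apply: carried0].
Qed.

Definition on_last (P : symb -> entry -> Prop) (w : symb) : Prop :=
  forall s p, w = rcons s p -> P s p.

Lemma on_last_rcons P s p : on_last P (rcons s p) <-> P s p.
Proof.
by split=> [/(_ s p erefl) // | Pp s' p' /rcons_inj[<- <-]].
Qed.

Lemma on_last_nil P : on_last P [::].
Proof. by case. Qed.

Definition last_range (a : nat) (s : symb) (p : entry) : Prop :=
  p.2.1 = 1 /\ 0 <= p.2.2 < p.1%:Z + a%:Z.

(** The last entry of a right factor of phi is created by the first index other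
than e_0, say e_(q^-r) after a steps, as (1, z q^r), and each of the a steps then
raises its weight by one.  So it is (a + 1, z q^r) with 0 <= r <= a when u lies
in both F^0 and F^(-1).  The general statement starts after a steps. *)
Lemma phi_rec_last a n u : in_stage a u ->
  carried (fun cw => on_last (last_range a) cw.2) (phi_rec n u).
Proof.
elim: n a u => [|n IHn] a u su; rewrite /phi_rec -/phi_rec; apply: carriedD;
  [exact: carried0 | by apply: carried_Const => _; apply: on_last_nil | |
   by apply: carried_Const => _; apply: on_last_nil].
apply: carried_id_S_comp => -[w e] /(partial_stage su) /= we -[c v] cv /=.
case: e we => [m am | sw].
  case/lastP: v {cv} => [|s p]; rewrite ?S_symb_Some /=; apply: carriedN; apply: carriedU.
    by apply/(@on_last_rcons _ [::]); rewrite /last_range /=; split=> //; lia.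
  by apply/on_last_rcons; rewrite /last_range /=; split=> //; lia.
have := IHn a.+1 w sw _ cv; case/lastP: v {cv} => [_|s p /on_last_rcons[p1 p2]].
  exact: carried0.
rewrite S_symb_None; apply: carriedU; apply/on_last_rcons.
by rewrite /last_range /=; split=> //; lia.
Qed.

(** * The substitution of zq for z *)

(** The substitution raises all levels by one, hence maps e_(q^-r) to
e_(q^-(r+1)). *)
Definition zq_omega (e : omega) : omega := omap (fun m => m - 1) e.

Definition zq_step : {malg rat[(symb * omega)%type]} -> {malg rat[(symb * omega)%type]} :=
  tmap (fun w : symb => << zq w >>) (fun e : omega => << zq_omega e >>).

Definition zq_right : {malg rat[(symb * symb)%type]} -> {malg rat[(symb * symb)%type]} :=
  tmap (fun c : symb => << c >>) (fun w : symb => << zq w >>).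

HB.instance Definition _ := GRing.Linear.on zq_step.
HB.instance Definition _ := GRing.Linear.on zq_right.

Lemma zq_stepU w e : zq_step << (w, e) >> = << (zq w, zq_omega e) >>.
Proof. by rewrite /zq_step /tmap lextU tensUU. Qed.

Lemma zq_rightU c w : zq_right << (c, w) >> = << (c, zq w) >>.
Proof. by rewrite /zq_right /tmap lextU tensUU. Qed.

Lemma nth_zq u i : nth entry0 (zq u) i = zq_entry (nth entry0 u i).
Proof. by elim: u i => [|p u IHu] [|i] //=. Qed.

Lemma dep_zq u i : dep (zq u) i = dep u i.
Proof. by rewrite /dep nth_zq. Qed.

Lemma sarg_zq u i : sarg (zq u) i = ((sarg u i).1, (sarg u i).2 + (sarg u i).1).
Proof. by rewrite /sarg nth_zq. Qed.

Lemma size_zq u : size (zq u) = size u.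
Proof. exact: size_map. Qed.

Lemma wf_zq u : wf (zq u) = wf u.
Proof. exact: wf_map. Qed.

Lemma zq_set_nth u i (p : entry) : (i < size u)%N ->
  set_nth entry0 (zq u) i (zq_entry p) = zq (set_nth entry0 u i p).
Proof. by move=> iu; rewrite !set_nthE size_zq iu /zq map_cat /= map_take map_drop. Qed.

Lemma zq_moved s u : moved s (zq u) = zq (moved s u).
Proof.
apply: (@eq_from_nth _ entry0); first by rewrite size_moved !size_zq size_moved.
by move=> i _; rewrite nth_moved !nth_zq nth_moved; case: ifP.
Qed.

Lemma zq_entryD k (x y : arg) :
  (k, (x.1, x.2 + x.1) + (y.1, y.2 + y.1)) = zq_entry (k, x + y).
Proof. by rewrite /zq_entry; congr (_, (_, _)); rewrite /= addrACA. Qed.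

Lemma D_A_zq v j : D_A (zq v) j = zq (D_A v j).
Proof.
case: j => [|i] /=; first by rewrite /zq behead_map.
by rewrite dep_zq !sarg_zq zq_entryD /zq map_cat /= map_take map_drop.
Qed.

Lemma D_B_zq v j : D_B (zq v) j = lext (fun w : symb => << zq w >>) (D_B v j).
Proof.
rewrite /D_B size_zq; case: ifP => _; last by rewrite linear0.
by rewrite lextU dep_zq !sarg_zq zq_entryD /zq map_cat /= map_take map_drop.
Qed.

Lemma zq_step_tens (A : QL) (E : QOmega) : zq_step (tens A E) =
  tens (lext (fun w : symb => << zq w >>) A) (lext (fun e : omega => << zq_omega e >>) E).
Proof. exact: tmapE. Qed.

Lemma D_up_zq v j : (j < size v)%N -> (sarg v j).1 = 1 \/ (sarg v j).1 = -1 ->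
  D_up (zq v) j = zq_step (D_up v j).
Proof.
move=> jv; rewrite /D_up sarg_zq dep_zq D_A_zq D_B_zq; case: (sarg v j) => h m /= hj.
have [k1|k1] := ltnP 1 (dep v j).
  rewrite zq_step_tens !lextU; congr (tens << _ >> _).
  exact: (zq_set_nth (_, (h, m))).
have zD x y : zq_step (x + y) = zq_step x + zq_step y by exact: linearD.
have zN x : zq_step (- x) = - zq_step x by exact: linearN.
have zE x y : lext (fun e : omega => << zq_omega e >>) (<< x >> - << y >>) =
    << zq_omega x >> - << zq_omega y >> by rewrite linearB /= !lextU.
case: hj => ->.
  rewrite eqxx zD zN.
  apply: (congr2 +%R); last by rewrite zq_step_tens zE /zq_omega /= opprD.
  by apply: congr1; rewrite zq_step_tens !lextU /zq_omega /= opprD.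
rewrite zD zN; apply: (congr2 +%R); first by rewrite zq_step_tens zE lextU.
by apply: congr1; rewrite zq_step_tens lextU.
Qed.

Lemma D_step_zq v j : (j < size v)%N -> (sarg v j).1 = 1 \/ (sarg v j).1 = -1 ->
  D_step (zq v) j = zq_step (D_step v j).
Proof.
move=> jv hj; rewrite /D_step sarg_zq /=.
case: ((sarg v j).1 == 1); first exact: D_up_zq.
have -> : qshift (-1) (zq v) j = zq (qshift (-1) v j).
  rewrite /qshift dep_zq sarg_zq -zq_set_nth //; congr set_nth.
  by congr (_, (_, _)); rewrite /= ?addr0 // addrAC.
rewrite D_up_zq ?linearN ?size_qshift //.
by rewrite /sarg nth_set_nth /= eqxx /= addr0.
Qed.

(** All levels are raised by one, so the path keeps its order. *)
Lemma std_order_zq u : wf u -> std_order (zq u) = std_order u.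
Proof.
move=> wu; rewrite /std_order size_zq.
have -> : [seq i <- iota 0 (size u) | (sarg (zq u) i).1 != 0] =
          [seq i <- iota 0 (size u) | (sarg u i).1 != 0].
  by apply: eq_filter => i; rewrite sarg_zq.
pose P := [pred l | ((sarg u l).1 != 0) && (l < size u)%N].
have lev l : l \in P -> level (sarg (zq u) l) = level (sarg u l) + 1.
  case/andP=> hl lu; have := sarg_z wu hl lu; rewrite sarg_zq /level.
  by case: (sarg u l) => h m /= [->|->] /=; lia.
(* Both orders agree only on the positions that are sorted. *)
rewrite -[X in sort _ X]map_id -[RHS]map_id.
apply: (homo_sort_map_in (P := P)) => [i j|j i k|i j|i j|].
- by move=> /lev Di /lev Dj /=; rewrite Di Dj; lia.
- by move=> /lev Di /lev Dj /lev Dk /=; rewrite Di Dj Dk; lia.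
- by move=> _ _ /=; lia.
- by move=> /lev Di /lev Dj /=; rewrite Di Dj; lia.
by apply/allP=> i; rewrite mem_filter mem_iota /= add0n.
Qed.

Lemma partial_zq u : wf u -> partial (zq u) = zq_step (partial u).
Proof.
move=> wu; rewrite !partialE ?wf_zq // std_order_zq // linear_sum.
apply: eq_big_nat => i /andP[_ iu]; rewrite zq_moved.
have := mem_nth 0%N iu; rewrite mem_std_order => /andP[hj ju].
by rewrite D_step_zq ?size_moved // sarg_moved1; apply: sarg_z.
Qed.

Definition z_only_last (s : symb) (p : entry) : Prop := z_free s /\ p.2.1 = 1.

Lemma phi_rec_last_z n u :
  carried (fun cw => on_last z_only_last cw.2) (phi_rec n u).
Proof.
elim: n u => [|n IHn] u; rewrite /phi_rec -/phi_rec; apply: carriedD;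
  [exact: carried0 | by apply: carried_Const => _; apply: on_last_nil | |
   by apply: carried_Const => _; apply: on_last_nil].
apply: carried_id_S_comp => -[w e] _ -[c v] /IHn /=.
case/lastP: v => [_|s p].
  case: e => [m|] /=; last exact: carried0.
  by apply: carriedN; apply: carriedU; apply/(@on_last_rcons _ [::]).
move/on_last_rcons=> [sz p1]; case: e => [m|].
  rewrite S_symb_Some; apply: carriedN; apply: carriedU; apply/on_last_rcons.
  by split=> //; rewrite /z_free all_rcons /=.
by rewrite S_symb_None; apply: carriedU; apply/on_last_rcons.
Qed.

Lemma zq_rcons s p : zq (rcons s p) = rcons (zq s) (zq_entry p).
Proof. exact: map_rcons. Qed.

Lemma S_symb_zq w e : on_last z_only_last w ->
  S_symb (zq w) (zq_omega e) = lext (fun w' : symb => << zq w' >>) (S_symb w e).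
Proof.
case/lastP: w => [_|s p /on_last_rcons[_ p1]].
  case: e => [m|] /=; last by rewrite linear0.
  by rewrite linearN /= lextU opprB addrC.
rewrite zq_rcons; case: e => [m|]; last by rewrite !S_symb_None lextU zq_rcons.
have E1 : p.2.2 + 1 - - (m - 1) = p.2.2 - - m + 0 by lia.
have E2 : - (m - 1) = - m + 1 by lia.
by rewrite !S_symb_Some linearN /= lextU !zq_rcons /zq_entry /= p1 E1 E2.
Qed.

Lemma z_free_zq u : z_free (zq u) = z_free u.
Proof. by rewrite /z_free all_map. Qed.

Lemma z_free_zqE u : z_free u -> zq u = u.
Proof.
elim: u => //= -[k [h m]] u IHu /andP[/= /eqP-> /IHu->].
by rewrite /zq_entry /= addr0.
Qed.

Lemma zq_right_tens c (v : QL) : zq_right (tens << c >> v) =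
  tens << c >> (lext (fun w : symb => << zq w >>) v).
Proof. by rewrite [LHS]tmapE lextU. Qed.

Lemma lext_zq_step (V : lmodType rat) (g : symb * omega -> V)
    (t : {malg rat[(symb * omega)%type]}) :
  lext g (zq_step t) = lext (fun we => g (zq we.1, zq_omega we.2)) t.
Proof.
rewrite (linear_basisE zq_step) linear_lext; apply: eq_lext => -[w e] _.
by rewrite /= zq_stepU lextU.
Qed.

Lemma lext_zq_right (V : lmodType rat) (g : symb * symb -> V)
    (t : {malg rat[(symb * symb)%type]}) :
  lext g (zq_right t) = lext (fun cw => g (cw.1, zq cw.2)) t.
Proof.
rewrite (linear_basisE zq_right) linear_lext; apply: eq_lext => -[c w] _.
by rewrite /= zq_rightU lextU.
Qed.

(** Induction on the weight: every ingredient of phi is compatible with the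
substitution, and the left factors, which do not contain z, are fixed. *)
Lemma phi_rec_zq n u : wf u -> phi_rec n (zq u) = zq_right (phi_rec n u).
Proof.
have C v : Const (zq v) = zq_right (Const v).
  rewrite /Const z_free_zq; case: ifP => [/z_free_zqE->|_]; last by rewrite linear0.
  by rewrite zq_rightU.
elim: n u => [|n IHn] u wu; rewrite /phi_rec -/phi_rec linearD C; congr (_ + _).
  by rewrite linear0.
rewrite partial_zq // /id_S_comp lext_zq_step [RHS](linear_lext zq_right).
apply: eq_lext => -[w e] /(partial_wf wu) /= [ww _].
apply: etrans (congr1 (lext _) (IHn w ww)) _.
rewrite [LHS]lext_zq_right [RHS](linear_lext zq_right).
apply: eq_lext => -[c v] /phi_rec_last_z /= lv.
by rewrite S_symb_zq // zq_right_tens.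
Qed.

Lemma phi_rec_weight n u : wf u ->
  carried (fun cw => (weight cw.1 <= weight u)%N) (phi_rec n u).
Proof.
elim: n u => [|n IHn] u wu; rewrite /phi_rec -/phi_rec; apply: carriedD;
  [exact: carried0 | exact: carried_Const | | exact: carried_Const].
apply: carried_id_S_comp => -[w e] /(partial_wf wu) /= [ww lw] -[c v].
by move=> /(IHn _ ww) /= lc v' _ /=; lia.
Qed.

Lemma weight_zq u : weight (zq u) = weight u.
Proof. by rewrite /weight big_map. Qed.

Lemma phi_zq u : wf u -> phi (zq u) = zq_right (phi u).
Proof. by move=> wu; rewrite /phi weight_zq phi_rec_zq. Qed.

(** Every step of the recursion removes one unit of weight, and the left factors
only come from constant terms. *)
Lemma phi_lower_weight u : wf u ->
  carried (fun cw => (weight cw.1 < weight u)%N) (phi u - Const u).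
Proof.
rewrite /phi => wu; move: {2}(weight u) => n; case: n => [|n]; rewrite /= addrK.
  exact: carried0.
apply: carried_id_S_comp => -[w e] /(partial_wf wu) /= [ww lw] -[c v].
by move=> /(phi_rec_weight ww) /= lc v' _ /=; lia.
Qed.

(** * Words and the maps pi *)

Lemma one_word : 1 = word [::].
Proof. by congr mkmalgU; exact: fmoneE. Qed.

Lemma word_cat s t : word s * word t = word (s ++ t).
Proof. by rewrite malgM_def fgmulUU mul1r; congr mkmalgU; exact: fmmulE. Qed.

Lemma b_word i s : b i * word s = word (i :: s).
Proof. exact: (word_cat [:: i]). Qed.

Lemma word_fm (w : {fmonom nat}) : << w >> = word w.
Proof. by rewrite /word fmK. Qed.

Definition weight_le (n : nat) : Qw -> Prop :=
  carried (fun w : {fmonom nat} => (sumn w <= n)%N).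

Lemma weight_leM m n u v : weight_le m u -> weight_le n v -> weight_le (m + n) (u * v).
Proof.
move=> mu nv; rewrite malgME big_seq; apply: carried_sum => w /mu wm.
rewrite big_seq; apply: carried_sum => w' /nv wn x.
move=> /(fsubsetP msuppU_le); rewrite in_fset1 => /eqP->.
by rewrite fmM sumn_cat leq_add.
Qed.

Lemma weight_le_leq m n u : (m <= n)%N -> weight_le m u -> weight_le n u.
Proof. by move=> mn; apply: carriedW => w /leq_trans->. Qed.

Lemma weight_le_word s : weight_le (sumn s) (word s).
Proof. exact: carriedU. Qed.

Lemma weight_le_b i : weight_le i (b i).
Proof. by apply: carriedU; rewrite /= addn0. Qed.

Lemma weight_le_beta n : weight_le n (beta n).
Proof.
elim: n => [|n IHn] /=; first exact: carried0.
apply: carriedD; first exact: weight_le_b.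
by apply: carriedN; apply: weight_le_leq IHn.
Qed.

(** The expansion of q^(nm) / (1 - q^m)^k in powers of x = q^m / (1 - q^m), where
the letter b_i stands for x^i: it is x^n (1 + x)^(k - n). *)
Definition letter (k n : nat) : Qw :=
  \sum_(s < (k - n).+1) 'C(k - n, s)%:R *: b (k - s).

Lemma F_cons p u : F (p :: u) = letter p.1 `|p.2.2|%N * F u.
Proof. by rewrite /F big_cons. Qed.

Lemma weight_le_F u : weight_le (weight u) (F u).
Proof.
elim: u => [|p u IHu].
  by rewrite /F big_nil /weight big_nil one_word; apply: weight_le_word.
rewrite F_cons weight_cons; apply: weight_leM => //.
apply: carried_sum => s _; apply: carriedZ.
exact: (@weight_le_leq _ p.1 _ (leq_subr s p.1) (@weight_le_b _)).
Qed.

Lemma F_rcons s p : F (rcons s p) = F s * letter p.1 `|p.2.2|%N.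
Proof. by rewrite /F big_rcons. Qed.

Lemma pascal_sum (V : lmodType rat) (m : nat) (f : nat -> V) :
  \sum_(s < m.+2) 'C(m.+1, s)%:R *: f s =
  \sum_(s < m.+1) 'C(m, s)%:R *: (f s + f s.+1).
Proof.
under [RHS]eq_bigr do rewrite scalerDr.
rewrite big_split /= big_ord_recl [X in _ = X + _]big_ord_recl /= !bin0 -addrA.
congr (_ + _); under eq_bigr do rewrite /bump /= binS natrD scalerDl.
rewrite big_split /=; congr (_ + _).
by rewrite big_ord_recr /= bin_small // scale0r addr0.
Qed.

Lemma letter_pascal k n : (n < k)%N ->
  letter k n = \sum_(s < k - n) 'C((k - n).-1, s)%:R *: (b (k - s) + b (k - s).-1).
Proof.
move=> nk; rewrite /letter; have -> : (k - n = (k - n).-1.+1)%N by lia.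
rewrite (pascal_sum _ (fun s => b (k - s))) /=.
by apply: eq_bigr => s _; rewrite subnS.
Qed.

(** Multiplication of the last letter by q^m = x / (1 + x), where b_i stands for
x^i.  The polynomial beta i = x (x^i - (-1)^i) / (1 + x) replaces the fraction
x^(i+1) / (1 + x); the corrections cancel in the combinations of letters that
are multiples of 1 + x, such as [letter k n] for n < k. *)
Definition raise : Qw -> Qw :=
  lext (fun w : {fmonom nat} =>
    if w : seq nat is i :: s then word (belast i s) * beta (last i s) else 1).

HB.instance Definition _ := GRing.Linear.on raise.

Lemma raise_word s i : raise (word (rcons s i)) = word s * beta i.
Proof.
rewrite /raise lextU; case: s => [|j s] /=; first by [].
by rewrite last_rcons belast_rcons.
Qed.

Lemma raise_b u i : raise (u * b i) = u * beta i.
Proof.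
rewrite -[u]lext_basis /lext !mulr_suml linear_sum; apply: eq_bigr => w _.
by rewrite -!scalerAl linearZ /= word_fm word_cat cats1 raise_word.
Qed.

Lemma b_beta i : (0 < i)%N -> beta i + beta i.-1 = b i.
Proof. by case: i => // i _; rewrite /= subrK. Qed.

Lemma letterS k n : (n < k)%N ->
  letter k n.+1 = \sum_(s < k - n) 'C((k - n).-1, s)%:R *: b (k - s).
Proof.
by move=> nk; rewrite /letter; have -> : (k - n = (k - n.+1).+1)%N by lia.
Qed.

(** After factoring out 1 + x by Pascal's rule, the last letter is a combination of
sums b_i + b_(i-1), which [raise] sends to b_i. *)
Lemma raise_letter u k n : (n < k)%N ->
  raise (u * letter k n) = u * letter k n.+1.
Proof.
move=> nk; rewrite (letter_pascal nk) (letterS nk).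
apply: etrans (congr1 raise (mulr_sumr _ _ _ _)) _.
rewrite [RHS]mulr_sumr linear_sum; apply: eq_bigr => s _.
rewrite [RHS]malg_scalerAr malg_scalerAr linearZ /=.
apply: (congr1 ( *:%R _)); rewrite mulrDr linearD /=.
rewrite [X in X + _]raise_b [X in _ + X]raise_b -mulrDr b_beta //.
by have := ltn_ord s; lia.
Qed.

Lemma raise_F w : on_last (last_range 0) w -> on_last z_only_last w -> raise (F w) = F (zq w).
Proof.
case/lastP: w => [_ _|s p /on_last_rcons[p1 pr] /on_last_rcons[sz _]].
  by rewrite /F /= big_nil one_word /raise lextU one_word.
rewrite zq_rcons (z_free_zqE sz) !F_rcons /= p1.
case: p p1 pr => k [h [m|m]] /= p1 pr; last by lia.
by rewrite raise_letter ?addn1 //=; lia.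
Qed.

Definition raise_right : word_pairs -> word_pairs :=
  tmap (fun w => << w >>) (fun w : {fmonom nat} => raise << w >>).

HB.instance Definition _ := GRing.Linear.on raise_right.

Lemma raise_right_tens u v : raise_right (tens u v) = tens u (raise v).
Proof. by rewrite [LHS]tmapE lext_basis -(linear_basisE raise). Qed.

Lemma tmap_zq_right t :
  carried (fun cw => on_last (last_range 0) cw.2 /\ on_last z_only_last cw.2) t ->
  tmap F F (zq_right t) = raise_right (tmap F F t).
Proof.
move=> lt; apply: etrans (lext_zq_right _ _) _.
apply: etrans _ (esym (linear_lext raise_right _ _)).
apply: eq_lext => -[c v] /lt[/= l1 l2].
by rewrite -[RHS]/(raise_right _) raise_right_tens raise_F.
Qed.

(** The right factors have a last entry (k, z q^n) with n < k, so the action of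
z -> zq on them becomes [raise] after applying pi_z. *)
Lemma phi_pi_zq u : carried (fun w => tame 0 w /\ tame (-1) w) u ->
  phi_pi (lext (fun w : symb => << zq w >>) u) = raise_right (phi_pi u).
Proof.
move=> tu; rewrite /phi_pi.
have -> : lext phi (lext (fun w : symb => << zq w >>) u) = zq_right (lext phi u).
  apply: etrans (linear_lext (lext phi) _ _) _.
  apply: etrans _ (esym (linear_lext zq_right _ _)).
  by apply: eq_lext => w /tu[/andP[ww _] _]; rewrite /= lextU phi_zq.
apply: tmap_zq_right; apply: carried_lext => w /tu tw cw wcw; split.
  exact: (@phi_rec_last 0%N _ _ tw _ wcw).
exact: (phi_rec_last_z wcw).
Qed.

(** The algebra morphism b_i |-> beta i, which sends b_i + b_(i-1) to b_i. *)
Definition unpair : Qw -> Qw := lext (fun w : {fmonom nat} => \prod_(i <- w) beta i).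

HB.instance Definition _ := GRing.Linear.on unpair.

Lemma unpair_b i u : unpair (b i * u) = beta i * unpair u.
Proof.
rewrite -[u]lext_basis /lext mulr_sumr !linear_sum mulr_sumr; apply: eq_bigr => w _.
rewrite malg_scalerAr; apply: etrans (linearZ _ _) _; rewrite linearZ /= malg_scalerAr.
by apply: (congr1 ( *:%R _)); rewrite word_fm b_word /unpair /word !lextU big_cons.
Qed.

Lemma unpair_F_BZ l : all (leq 1) l -> unpair (F_BZ l) = word l.
Proof.
elim: l => [_|i l IHl /= /andP[i0 /IHl Dl]].
  by rewrite /F_BZ big_nil one_word /unpair lextU big_nil one_word.
rewrite /F_BZ big_cons mulrDl linearD /= [X in X + _]unpair_b [X in _ + X]unpair_b.
by rewrite -/(F_BZ l) -mulrDl b_beta // Dl b_word.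
Qed.

Lemma weight_le_unpair s : weight_le (sumn s) (unpair (word s)).
Proof.
rewrite /unpair lextU /=; elim: s => [|i s IHs].
  by rewrite big_nil one_word; apply: (@weight_le_word [::]).
by rewrite big_cons; apply: weight_leM => //; apply: weight_le_beta.
Qed.

(** * Regularization *)

Definition trailing_zeros (s : seq nat) : nat := find (fun i => i != 0%N) (rev s).

Lemma stuffle0r s : stuffle_word s [::] = word s.
Proof. by case: s. Qed.

Lemma stuffle_word_cons i s j t :
  stuffle_word (i :: s) (j :: t) = b i * stuffle_word s (j :: t)
    + b j * stuffle_word (i :: s) t + b (i + j) * stuffle_word s t.
Proof. by []. Qed.

Definition fewer_zeros (n : nat) : Qw -> Prop :=
  carried (fun w : {fmonom nat} =>
    exists s i t, (w : seq nat) = s ++ i.+1 :: nseq t 0%N /\ (t < n)%N).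

Lemma carried_bM (Q Q' : {fmonom nat} -> Prop) i u :
  (forall w : {fmonom nat}, Q w -> Q' (FMonom (i :: w))) -> carried Q u -> carried Q' (b i * u).
Proof.
move=> QQ' Qu; rewrite -[u]lext_basis /lext mulr_sumr big_seq; apply: carried_sum => w /Qu Qw.
by rewrite malg_scalerAr word_fm b_word; apply: carriedZ; apply: carriedU; apply: QQ'.
Qed.

Lemma fewer_zeros_b n i u : fewer_zeros n u -> fewer_zeros n (b i * u).
Proof.
by apply: carried_bM => w [s [j [t [-> tn]]]]; exists (i :: s), j, t.
Qed.

Lemma fewer_zeros_leq m n u : (m <= n)%N -> fewer_zeros m u -> fewer_zeros n u.
Proof.
move=> mn; apply: carriedW => w [s [j [t [-> tn]]]]; exists s, j, t.
by rewrite (leq_trans tn).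
Qed.

Lemma stuffle_nil_word t : stuffle_word [::] t = word t.
Proof. by []. Qed.

(** Let the word not end with b_0.  To have n letters b_0 at the end of a term of
its stuffle product with b_0^n, all of them must come after the word, and none
may be absorbed by another letter. *)
Lemma stuffle_zeros s i n :
  fewer_zeros n (stuffle_word (rcons s i.+1) (nseq n 0%N) - word (rcons s i.+1 ++ nseq n 0%N)).
Proof.
have fewer_zerosS v m : fewer_zeros m (stuffle_word (rcons v i.+1) (nseq m 0%N)
      - word (rcons v i.+1 ++ nseq m 0%N)) ->
    fewer_zeros m.+1 (stuffle_word (rcons v i.+1) (nseq m 0%N)).
  move=> lm; rewrite -[stuffle_word _ _](subrK (word (rcons v i.+1 ++ nseq m 0%N))).
  apply: carriedD; first exact: (fewer_zeros_leq (leqnSn m) lm).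
  by apply: carriedU; exists v, i, m; rewrite /= cat_rcons.
have zm (a c d e : Qw) : a + c + d - e = (a - e) + (c + d).
  by rewrite -!addrA; congr (_ + _); rewrite addrC -addrA addrC addrA addrC.
elim: s n => [|j s IHs] n; elim: n => [|n IHn].
- by rewrite cats0 stuffle0r subrr; apply: carried0.
- rewrite [rcons _ _]/= [nseq n.+1 _]/= stuffle_word_cons addn0 zm.
  rewrite stuffle_nil_word b_word subrr add0r; apply: carriedD.
    by apply: fewer_zeros_b; apply: (fewer_zerosS [::]).
  by rewrite stuffle_nil_word b_word; apply: carriedU; exists [::], i, n.
- by rewrite cats0 stuffle0r subrr; apply: carried0.
rewrite [rcons _ _]/= [nseq n.+1 _]/= stuffle_word_cons addn0 zm.
have l1 : fewer_zeros n.+1 (stuffle_word (j :: rcons s i.+1) (nseq n 0%N)).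
  exact: (fewer_zerosS (j :: s) n IHn).
have l2 : fewer_zeros n.+1 (stuffle_word (rcons s i.+1) (nseq n 0%N)).
  exact: (fewer_zerosS s n (IHs n)).
have -> : word ((j :: rcons s i.+1) ++ 0%N :: nseq n 0%N) =
  b j * word (rcons s i.+1 ++ nseq n.+1 0%N) by rewrite b_word.
apply: carriedD; last exact: (carriedD (@fewer_zeros_b _ 0%N _ l1) (@fewer_zeros_b _ j _ l2)).
by rewrite -(mulrBr (b j)); apply: fewer_zeros_b; apply: (IHs n.+1).
Qed.

Lemma stuffle_zero_zeros n : stuffle_word [:: 0%N] (nseq n 0%N) =
  n.+1%:R *: word (nseq n.+1 0%N) + n%:R *: word (nseq n 0%N).
Proof.
elim: n => [|n IHn]; first by rewrite scale1r scale0r addr0.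
rewrite [nseq n.+1 _]/= stuffle_word_cons IHn !stuffle_nil_word !b_word addn0.
have bZ (c : rat) s : b 0 * (c *: word s) = c *: word (0%N :: s).
  by rewrite malg_scalerAr b_word.
rewrite mulrDr [X in _ + (X + _) + _]bZ [X in _ + (_ + X) + _]bZ /=.
rewrite [n.+2%:R]mulrS [n.+1%:R in X in _ = _ + X]mulrS !scalerDl !scale1r.
have zm (x y z t : Qw) : x + (y + z) + t = (x + y) + (t + z).
  by rewrite -!addrA [z + t]addrC.
exact: zm.
Qed.

(** The leading coefficient is n!. *)
Lemma stuffle_powE n : exists a : nat -> rat, a n != 0 /\
  stuffle_pow (b 0) n = \sum_(i < n.+1) a i *: word (nseq i 0%N).
Proof.
elim: n => [|n [a [an Dn]]].
  by exists (fun=> 1); split=> //; rewrite big_ord1 scale1r -one_word.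
rewrite /stuffle_pow iterS -/(stuffle_pow (b 0) n) Dn.
have -> : stuffle (b 0) (\sum_(i < n.+1) a i *: word (nseq i 0%N)) =
    \sum_(i < n.+1) a i *: (i.+1%:R *: word (nseq i.+1 0%N) + i%:R *: word (nseq i 0%N)).
  rewrite {1}/stuffle /b lextU (linear_sum (lext _)); apply: eq_bigr => i _.
  by rewrite -stuffle_zero_zeros; apply: etrans (linearZ _ _) _;
    apply: (congr1 ( *:%R _)); apply: lextU.
pose a' i := (if i is j.+1 then a j * j.+1%:R else 0)
  + (if (i <= n)%N then a i * i%:R else 0).
exists a'; split; first by rewrite /a' ltnn addr0 mulf_neq0 // pnatr_eq0.
under eq_bigr do rewrite scalerDr !scalerA.
rewrite big_split /= /a'; under [RHS]eq_bigr do rewrite scalerDl.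
rewrite [RHS]big_split /=; apply: (congr2 +%R).
  by rewrite [RHS]big_ord_recl scale0r add0r.
rewrite [RHS]big_ord_recr /= ltnn scale0r addr0; apply: eq_bigr => i _.
by rewrite -ltnS ltn_ord.
Qed.

Lemma trailing_zeros_cat s n : last 1%N s != 0%N -> trailing_zeros (s ++ nseq n 0%N) = n.
Proof.
move=> ls; rewrite /trailing_zeros rev_cat rev_nseq find_cat has_nseq andbF size_nseq.
by case/lastP: s ls => [|s x]; rewrite ?addn0 // last_rcons rev_rcons /= => ->; rewrite addn0.
Qed.

Lemma trailing_zeros_nseq s i n : trailing_zeros (s ++ i.+1 :: nseq n 0%N) = n.
Proof. by rewrite -cat_rcons trailing_zeros_cat // last_rcons. Qed.

Lemma mcoeff_stuffle_zeros w' w m n : last 1%N w' != 0%N -> last 1%N w != 0%N ->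
  (m <= n)%N -> (stuffle_word w' (nseq m 0%N))@_(FMonom (w ++ nseq n 0%N)) =
    ((m == n) && (w' == w))%:R.
Proof.
move=> lw' lw mn; have l : fewer_zeros m (stuffle_word w' (nseq m 0%N) - word (w' ++ nseq m 0%N)).
  case/lastP: w' lw' => [|s [|i]]; rewrite ?last_rcons // => _.
    by rewrite stuffle_nil_word subrr; apply: carried0.
  exact: stuffle_zeros.
rewrite -[stuffle_word _ _](subrK (word (w' ++ nseq m 0%N))) mcoeffD.
rewrite mcoeff_outdom ?add0r; last first.
  apply/negP=> /l[s [i [t [/(congr1 trailing_zeros)]]]].
  rewrite /= trailing_zeros_nseq trailing_zeros_cat //.
  by move=> <-; rewrite ltnNge mn.
rewrite mcoeffU fmP /=; congr ((nat_of_bool _)%:R); apply/idP/andP=> [/eqP E|[/eqP-> /eqP->] //].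
have := congr1 trailing_zeros E; rewrite !trailing_zeros_cat // => mn'; split; first exact/eqP.
have sz : size w' = size w by have := congr1 size E; rewrite !size_cat !size_nseq mn' => /addIn.
by move/eqP: E; rewrite eqseq_cat // => /andP[].
Qed.

Lemma mcoeff_lext (K L : choiceType) (f : K -> {malg rat[L]}) u l :
  (lext f u)@_l = \sum_(k <- msupp u) u@_k * (f k)@_l.
Proof. by rewrite /lext raddf_sum; apply: eq_bigr => k _; rewrite /= mcoeffZ. Qed.

(** The words ending with exactly n letters b_0 isolate the coefficient of the n-th
power in a polynomial of degree n in b_0 for the stuffle product. *)
Lemma mcoeff_stuffle_pow n : exists2 a : rat, a != 0 &
  forall m c (w : {fmonom nat}), supported adm c -> adm w -> (m <= n)%N ->
    (stuffle c (stuffle_pow (b 0) m))@_(FMonom (w ++ nseq n 0%N)) =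
    if m == n then a * c@_w else 0.
Proof.
pose X (w : {fmonom nat}) := FMonom (w ++ nseq n 0%N).
have coef m c (w : {fmonom nat}) (a : nat -> rat) : supported adm c -> adm w ->
    (m <= n)%N -> stuffle_pow (b 0) m = \sum_(i < m.+1) a i *: word (nseq i 0%N) ->
    (stuffle c (stuffle_pow (b 0) m))@_(X w) = (m == n)%:R * (a m * c@_w).
  move=> ac aw mn ->; rewrite mcoeff_lext.
  have E (w' : {fmonom nat}) : w' \in msupp c -> (lext (fun t : {fmonom nat} =>
      stuffle_word w' t) (\sum_(i < m.+1) a i *: word (nseq i 0%N)))@_(X w) =
      (m == n)%:R * (a m * (w' == w)%:R).
    move=> /ac aw'; rewrite (linear_sum (lext _)) (raddf_sum (mcoeff (X w))) big_ord_recr /=.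
    rewrite big1 ?add0r => [|[i im] _]; rewrite linearZ /= mcoeffZ /word lextU.
      by rewrite mcoeff_stuffle_zeros // mulrCA fmP; case: eqVneq; rewrite ?mul1r // !mul0r.
    rewrite /= mcoeff_stuffle_zeros //; last by rewrite ltnW // (leq_trans im).
    by rewrite (ltn_eqF (leq_trans im mn)) mulr0.
  rewrite big_seq (eq_bigr _ (fun w' w'c => congr1 ( *%R _) (E w' w'c))) -big_seq.
  have [wc|wc] := boolP (w \in msupp c); last first.
    rewrite (mcoeff_outdom wc) !mulr0 big_seq big1 // => w' w'c.
    by case: (eqVneq w' w) wc => [<-|_ _]; rewrite ?w'c // !mulr0.
  rewrite (big_fsetD1 w) //= eqxx mulr1 big_seq big1 ?addr0.
    by ring.
  by move=> w'; rewrite in_fsetD1 => /andP[/negPf-> _]; rewrite !mulr0.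
have [a [an Dn]] := stuffle_powE n; exists (a n) => // m c w ac aw mn.
have [mn'|mn'] := eqVneq m n; last first.
  have [a' [_ Dm]] := stuffle_powE m.
  by rewrite -/(X w) (coef m c w a') // (negPf mn') mul0r.
by rewrite -/(X w) (coef m c w a) ?mn' // eqxx mul1r.
Qed.

Lemma stuffle1 c : stuffle c 1 = c.
Proof.
rewrite one_word -[RHS]lext_basis; apply: eq_lext => w _.
by rewrite /word lextU stuffle0r word_fm.
Qed.

(** In any expansion of an admissible element as a polynomial in b_0, the leading
coefficient vanishes unless the degree is 0. *)
Lemma is_reg_adm u u0 : supported adm u -> is_reg u u0 -> u0 = u.
Proof.
move=> au [c [n [ac Du ->]]]; elim: n Du => [|n IHn] Du.
  by rewrite Du big_ord1 stuffle1.
apply: IHn; rewrite Du big_ord_recr /=.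
suff -> : c n.+1 = 0 by rewrite [X in _ + X]linear0 addr0.
apply/malgP => w; rewrite mcoeff0.
have [aw|aw] := boolP (adm w); last by apply/mcoeff_outdom/(contraNN _ aw)/ac.
have [a an coef] := mcoeff_stuffle_pow n.+1.
have := congr1 (mcoeff (FMonom (w ++ nseq n.+1 0%N))) Du.
rewrite mcoeff_outdom; last first.
  by apply/negP=> /au; rewrite /adm /= last_cat; elim: (n).
rewrite (raddf_sum (mcoeff _)) big_ord_recr /=.
rewrite [X in _ + X](coef n.+1 (c n.+1) w (ac _) aw (leqnn _)) eqxx.
rewrite big1 ?add0r => [/esym/eqP|[i im] _].
  by rewrite mulf_eq0 (negPf an) => /eqP.
by rewrite [LHS](coef i (c i) w (ac _) aw (ltnW im)) (ltn_eqF im).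
Qed.

Lemma reg_adm u : supported adm u -> reg u = u.
Proof.
move=> au; apply: is_reg_adm => //; apply: epsilon_spec.
exists u, (fun=> u), 0%N; split=> //.
by rewrite big_ord1 stuffle1.
Qed.

(** * The elements Theta *)

Lemma Theta_symb_cons x k y e : Theta_symb (x :: k) (y :: e) =
  (x, ((y : nat)%:Z - (nth false e 0 : nat)%:Z, x%:Z - 1 + (nth false e 0 : nat)%:Z))
    :: Theta_symb k e.
Proof.
have iotaS : iota 1 (size k) = map (addn 1) (iota 0 (size k)) by rewrite -iotaDl.
rewrite /Theta_symb /= iotaS -map_comp.
by congr (_ :: _); apply: eq_map => i.
Qed.

(** The exponents of z telescope. *)
Lemma zdeg_Theta k e : size e = size k ->
  zdeg (Theta_symb k e) = (nth false e 0 : nat)%:Z.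
Proof.
elim: k e => [|x k IHk] [|y e] //= => [_|[/IHk De]]; first by rewrite zdeg_nil.
by rewrite Theta_symb_cons zdeg_cons De /= subrK.
Qed.

Lemma wf_cons p u : wf (p :: u) = [&& (0 < p.1)%N, 0 <= zdeg (p :: u) <= 1 & wf u].
Proof. by []. Qed.

Lemma wf_Theta k e : all (leq 1) k -> size e = size k -> wf (Theta_symb k e).
Proof.
elim: k e => [|x k IHk] [|y e] // /andP[x0 k0] [se].
have D : zdeg (Theta_symb (x :: k) (y :: e)) = (y : nat)%:Z.
  by rewrite zdeg_Theta //= se.
rewrite Theta_symb_cons wf_cons -Theta_symb_cons D /= IHk //.
by rewrite andbT [(0 < x)%N]x0; case: (y).
Qed.

(** The exponent of q in the i-th argument is k_i - 1 + eps_(i+1), and it becomes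
k_i - 1 + eps_i after z -> zq: both lie between 0 and k_i. *)
Lemma tame_Theta k e : all (leq 1) k -> size e = size k ->
  tame 0 (Theta_symb k e) /\ tame (-1) (Theta_symb k e).
Proof.
move=> k0 se; rewrite /tame wf_Theta //=; elim: k e k0 se => [|x k IHk] [|y e] //.
move=> /andP[x0 k0] [/(IHk _ k0)[r0 r1]]; rewrite !Theta_symb_cons /= r0 r1 !andbT.
rewrite /= in x0.
by rewrite /in_range /=; case: y; case: (nth _ _ _) => /=; lia.
Qed.

Lemma weight_Theta k e : size e = size k -> weight (Theta_symb k e) = sumn k.
Proof.
elim: k e => [|x k IHk] [|y e] // => [_|[/IHk De]]; first by rewrite /weight big_nil.
by rewrite Theta_symb_cons weight_cons De.
Qed.

(** For [Ind_BZ] indices the last exponent is at least k_d - 1 > 0.  This makes every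
suffix product without z a positive power of q, and excludes the argument z in
the last position. *)
Definition positive_end (s : symb) (p : entry) : Prop := 1 <= p.2.2.

Lemma in_G_tame u : tame 0 u -> on_last positive_end u -> in_G u.
Proof.
case/andP=> wu ru lu.
have pos p : p \in u -> 0 <= p.2.2 by move/(allP ru); rewrite /in_range mul0r subr0 => /andP[].
rewrite /in_G /in_Fn /in_Fhat -!andbA; apply/and4P; split=> //.
- apply/allP=> -[k [h m]] /(wf_entry wu)[/= -> h1]; rewrite !inE /=.
  by lia.
- apply/allP=> i; rewrite mem_iota add0n => iu.
  have wd : wf (drop i u) by move: wu; rewrite -{1}(cat_take_drop i u) => /wf_suffix.
  have D1 : (\sum_(p <- drop i u) p.2).1 = zdeg (drop i u).
    by rewrite /zdeg; elim: (drop i u) => [|p s IHs]; rewrite ?big_nil // !big_cons -IHs.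
  have D2 : (\sum_(p <- drop i u) p.2).2 = \sum_(p <- drop i u) p.2.2.
    by elim: (drop i u) => [|p s IHs]; rewrite ?big_nil // !big_cons -IHs.
  rewrite /= D1 D2; have d2 : 0 < \sum_(p <- drop i u) p.2.2.
    have sub : {subset drop i u <= u} by move=> q; apply: mem_drop.
    have sd : (0 < size (drop i u))%N by rewrite size_drop; lia.
    case/lastP Ed: (drop i u) sub sd => [//|s p] sub _.
    have p1 := lu (take i u ++ s) p; rewrite /positive_end rcons_cat -Ed cat_take_drop in p1.
    rewrite -cats1 big_cat big_seq1 /=; apply: ltr_wpDl; last by have := p1 erefl; lia.
    rewrite big_seq; apply: sumr_ge0 => q qs; apply/pos/sub.
    by rewrite mem_rcons in_cons qs orbT.
  by rewrite d2 andbT; have := wf_zdeg wd; lia.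
case/lastP: u lu {wu ru pos} => [|s p] // /on_last_rcons p1.
rewrite map_rcons last_rcons; apply/orP; right; apply/eqP=> E.
by move: p1; rewrite /positive_end E.
Qed.

Lemma positive_end_cons p u : (u = [::] -> 1 <= p.2.2) ->
  on_last positive_end u -> on_last positive_end (p :: u).
Proof.
move=> p1 lu [|p' s] q /= [Dp Du]; first by rewrite /positive_end -Dp p1.
exact: (lu s q Du).
Qed.

Lemma Theta_end (f : entry -> entry) k e : (1 < last 2 k)%N -> size e = size k ->
  (forall (x : nat) (y z : bool), (1 < x)%N ->
     1 <= (f (x, ((y : nat)%:Z - (z : nat)%:Z, x%:Z - 1 + (z : nat)%:Z))).2.2) ->
  on_last positive_end [seq f p | p <- Theta_symb k e].
Proof.
move=> k2 se fP; elim: k e k2 se => [|x k IHk] [|y e] //.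
  by move=> _ _; apply: on_last_nil.
move=> k2 [se].
rewrite Theta_symb_cons map_cons; apply: positive_end_cons.
  move/(congr1 size); rewrite !size_map size_iota => /size0nil Dk.
  rewrite Dk in k2 se; rewrite (size0nil se); exact: (fP x y false k2).
by apply: IHk => //; case: k k2 {se}.
Qed.

Lemma in_G_Theta k e : Ind_BZ k -> size e = size k ->
  in_G (Theta_symb k e) /\ in_G (zq (Theta_symb k e)).
Proof.
move=> /andP[k0 k2] se; have [t0 t1] := tame_Theta k0 se; split.
  apply: in_G_tame => //; rewrite -[Theta_symb k e]map_id; apply: Theta_end => //.
  by move=> x y [] /=; lia.
apply: in_G_tame; last first.
  by apply: Theta_end => // x [] [] /=; lia.
case/andP: t1 => w r; rewrite /tame wf_zq w all_map /=; apply: sub_all r => p.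
by rewrite /in_range /=; lia.
Qed.

Lemma big_tuple_cons (V : zmodType) n (G : seq bool -> V) :
  \sum_(e : n.+1.-tuple bool) G e =
  \sum_(y : bool) \sum_(e : n.-tuple bool) G (y :: e).
Proof.
rewrite pair_bigA /=.
rewrite (reindex (fun p : bool * n.-tuple bool => [tuple of p.1 :: p.2])) //=.
exists (fun e => (thead e, [tuple of behead e])) => [[y e] _|e _].
  by rewrite /= theadE; congr (_, _); apply: val_inj.
by rewrite [RHS]tuple_eta.
Qed.

Lemma big_tuple0 (V : zmodType) (G : seq bool -> V) :
  \sum_(e : 0.-tuple bool) G e = G [::].
Proof.
rewrite (bigD1 [tuple]) //= big1 ?addr0 // => e /eqP[].
exact: tuple0.
Qed.

Definition forget_z (u : symb) : symb := [seq (p.1, (0, p.2.2)) | p : nat * arg <- u].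

Definition signed_sum (V : lmodType rat) (k : seq nat) (g : symb -> V) : V :=
  \sum_(e : (size k).-tuple bool) (-1) ^+ (\sum_(x <- e) x)%N *: g (Theta_symb k e).

Lemma lext_Theta (V : lmodType rat) (g : symb -> V) k :
  lext g (Theta k) = signed_sum k g.
Proof.
rewrite /Theta (linear_sum (lext g)); apply: eq_bigr => e _.
by apply: etrans (linearZ _ _) _; apply: (congr1 ( *:%R _)); apply: lextU.
Qed.

Lemma signed_sum_cons (V : lmodType rat) x k (g : symb -> V) :
  signed_sum (x :: k) g =
  \sum_(e : (size k).-tuple bool) (-1) ^+ (\sum_(y <- e) y)%N *:
     (g (Theta_symb (x :: k) (false :: e)) - g (Theta_symb (x :: k) (true :: e))).
Proof.
rewrite /signed_sum /= (big_tuple_cons _ (fun e : seq bool =>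
  (-1) ^+ (\sum_(y <- e) y)%N *: g (Theta_symb (x :: k) e))).
rewrite big_bool /= addrC -big_split; apply: eq_bigr => e _ /=.
rewrite !big_cons -[nat_of_bool false]/0%N -[nat_of_bool true]/1%N.
by rewrite exprS add0n scalerBr mulN1r scaleNr.
Qed.

Lemma carried_Theta (Q : symb -> Prop) k :
  (forall e, size e = size k -> Q (Theta_symb k e)) -> carried Q (Theta k).
Proof.
move=> QT; apply: carried_sum => e _; apply: carriedZ; apply: carriedU.
by apply: QT; rewrite size_tuple.
Qed.

(** At z = 1 the sign eps_1 no longer occurs in the arguments. *)
Lemma at_z1_Theta x k : at_z1 (Theta (x :: k)) = 0.
Proof.
rewrite /at_z1 lext_Theta signed_sum_cons big1 // => e _.
by rewrite !Theta_symb_cons /= subrr scaler0.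
Qed.

Lemma letter_pred x : (0 < x)%N -> letter x x.-1 = b x + b x.-1.
Proof.
move=> x0; rewrite /letter; have -> : (x - x.-1 = 1)%N by lia.
by rewrite big_ord_recl big_ord1 /= bin0 binn !scale1r subn0 subn1.
Qed.

Lemma letter_self x : letter x x = b x.
Proof. by rewrite /letter subnn big_ord1 bin0 scale1r subn0. Qed.

(** At z = q the arguments are q^(k_i - 1 + eps_i), so the alternating sum factors
into the letters x^(k-1) (1 + x) - x^k = x^(k-1). *)
Lemma pi_at_z1_zq_Theta k : all (leq 1) k ->
  Defs.pi (at_z1 (lext (fun w : symb => << zq w >>) (Theta k))) = word (map predn k).
Proof.
move=> k0.
have -> : Defs.pi (at_z1 (lext (fun w : symb => << zq w >>) (Theta k))) =
    signed_sum k (fun w => F (forget_z (zq w))).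
  rewrite -lext_Theta; apply: etrans (congr1 Defs.pi (linear_lext (lext _) _ _)) _.
  apply: etrans (linear_lext (lext _) _ _) _; apply: eq_lext => w _.
  by rewrite /= !lextU.
elim: k k0 => [_|x k IHk /= /andP[x0 /IHk Dk]].
  rewrite /signed_sum (big_tuple0 (fun e : seq bool =>
    (-1) ^+ (\sum_(y <- e) y)%N *: F (forget_z (zq (Theta_symb [::] e))))).
  by rewrite big_nil scale1r /F big_nil one_word.
rewrite signed_sum_cons -b_word -Dk /signed_sum mulr_sumr; apply: eq_bigr => e _.
rewrite malg_scalerAr; apply: (congr1 ( *:%R _)).
have D (y : bool) : F (forget_z (zq (Theta_symb (x :: k) (y :: e)))) =
    letter x (x.-1 + y) * F (forget_z (zq (Theta_symb k e))).
  rewrite Theta_symb_cons F_cons /=; congr (letter _ _ * _).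
  by case: (nth _ _ _); case: (y) => /=; lia.
rewrite (D false) (D true); apply: etrans (esym (mulrBl _ _ _)) _.
apply: (congr1 ( *%R^~ _)); rewrite addn0 letter_pred // addn1 prednK // letter_self.
by rewrite addrAC subrr add0r.
Qed.

Lemma z_free_Theta k e : size e = size k ->
  z_free (Theta_symb k e) = (e == nseq (size k) false).
Proof.
elim: k e => [|x k IHk] [|y e] // [se].
rewrite Theta_symb_cons /z_free [all _ _]/= -/(z_free _) IHk // eqseq_cons.
case: (eqVneq e (nseq (size k) false)) => [->|_]; last by rewrite !andbF.
by rewrite !andbT; case: (k) => [|? ?]; case: (y).
Qed.

Lemma F_Theta0 k : all (leq 1) k ->
  F (Theta_symb k (nseq (size k) false)) = F_BZ k.
Proof.
elim: k => [_|x k IHk /andP[x0 /IHk Dk]]; first by rewrite /F /F_BZ !big_nil.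
rewrite [nseq _ _]/= Theta_symb_cons F_cons Dk /F_BZ big_cons; congr (_ * _).
rewrite -letter_pred //=; congr (letter _ _).
by move: x0; case: (k) => [|? ?] /=; lia.
Qed.

Lemma Const_Theta k : lext Const (Theta k) =
  << (Theta_symb k (nseq (size k) false), [::]) >>.
Proof.
rewrite lext_Theta /signed_sum (bigD1 [tuple of nseq (size k) false]) //=.
rewrite [X in _ + X]big1 ?addr0 => [|e ne]; last first.
  rewrite /Const z_free_Theta ?size_tuple // ifN ?scaler0 //.
rewrite /Const z_free_Theta ?size_nseq // eqxx big1_seq ?scale1r // => y.
by rewrite mem_nseq => /andP[_ /andP[_ /eqP->]].
Qed.

(** The constant term of phi only sees the symbol with all eps_i = 0, whose
arguments q^(k_i - 1) give F_BZ(k). *)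
Lemma phi_pi_Theta k : all (leq 1) k ->
  carried (fun ww : {fmonom nat} * {fmonom nat} => (sumn ww.1 < sumn k)%N)
    (phi_pi (Theta k) - tens (F_BZ k) 1).
Proof.
move=> k0; pose t := lext (fun u => phi u - Const u) (Theta k).
have -> : phi_pi (Theta k) - tens (F_BZ k) 1 = tmap F F t.
  have Dt : t = lext phi (Theta k) - lext Const (Theta k).
    by rewrite /t lextB.
  rewrite /phi_pi Dt [RHS]linearB; apply: (congr2 +%R) => //; apply: (congr1 -%R).
  apply: esym; apply: etrans (congr1 (tmap F F) (Const_Theta k)) _.
  apply: etrans (tmapU _ _ _ _) _.
  by apply: (congr2 (@tens _ _)); [apply: F_Theta0 | rewrite /F big_nil].
apply: carried_lext => -[c v] cv.
apply: carried_tens => w w' /weight_le_F /= wc _.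
have: carried (fun cw => (weight cw.1 < sumn k)%N) t.
  apply: carried_lext; apply: carried_Theta => e se.
  by rewrite -(weight_Theta se); apply/phi_lower_weight/wf_Theta.
by move/(_ _ cv) => /= cl; apply: leq_ltn_trans cl.
Qed.

(** * Dual indices *)

Lemma unblocks_cons a p s :
  unblocks a (p :: s) = rcons (nseq p.2.-1 a) (p.1 + a)%N ++ unblocks a s.
Proof. by []. Qed.

Lemma dual_BZ_SZ w : dual_BZ (map succn w) = map succn (dual_SZ w).
Proof.
have B n : blocks_rec 1 n (map succn w) = blocks_rec 0 n w.
  by elim: w n => //= x w IHw n; rewrite eqSS !IHw subSS.
rewrite /dual_BZ /dual_SZ /dual /blocks B; elim: (map _ _) => //= p s IHs.
rewrite !unblocks_cons map_cat map_rcons map_nseq IHs.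
by rewrite addn0 addn1.
Qed.

Definition pos_pair (p : nat * nat) : bool := (0 < p.1)%N && (0 < p.2)%N.

Lemma blocks_pos n w : all pos_pair (blocks_rec 0 n w).
Proof.
elim: w n => //= x w IHw n; case: eqVneq => [|x0] //=.
by rewrite IHw /pos_pair /= subn0 lt0n x0.
Qed.

Lemma swap_pos s : all pos_pair s ->
  all pos_pair [seq (p.2, p.1) | p : nat * nat <- rev s].
Proof.
move=> ps; rewrite all_map all_rev; apply: sub_all ps => p.
by rewrite /pos_pair /= andbC.
Qed.

Lemma adm_unblocks s : all pos_pair s -> last 1%N (unblocks 0 s) != 0%N.
Proof.
case/lastP: s => // s [c d]; rewrite all_rcons => /andP[/andP[/= c0 _] _].
rewrite /unblocks map_rcons flatten_rcons last_cat last_rcons addn0.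
by rewrite -lt0n.
Qed.

Lemma adm_dual_SZ (w : seq nat) : last 1%N (dual_SZ w) != 0%N.
Proof. by apply/adm_unblocks/swap_pos/blocks_pos. Qed.

Lemma dual_SZK (w : seq nat) : last 1%N w != 0%N -> dual_SZ (dual_SZ w) = w.
Proof.
move=> lw; rewrite /dual_SZ /dual unblocksK; last exact/swap_pos/blocks_pos.
have swapK (s : seq (nat * nat)) :
    [seq (p.2, p.1) | p <- [seq (p.2, p.1) | p <- s]] = s.
  by elim: s => //= -[c d] s ->.
rewrite -map_rev revK swapK.
by rewrite blocksK //; apply/allP.
Qed.

Lemma Ind_BZ_succ w : Ind_BZ (map succn w) = (last 1%N w != 0%N).
Proof.
rewrite /Ind_BZ; have -> : all (leq 1) (map succn w) by elim: w.
by rewrite (last_map succn) ltnS lt0n.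
Qed.

Lemma Ind_BZP k : Ind_BZ k -> exists2 w, last 1%N w != 0%N & k = map succn w.
Proof.
move=> kP; have Dk : k = map succn (map predn k).
  have [k0 _] := andP kP; rewrite -map_comp -[LHS]map_id.
  by apply/eq_in_map=> x /(allP k0); case: x.
by exists (map predn k) => //; rewrite -Ind_BZ_succ -Dk.
Qed.

Lemma dual_BZK k : Ind_BZ k -> Ind_BZ (dual_BZ k) /\ dual_BZ (dual_BZ k) = k.
Proof.
case/Ind_BZP=> w lw ->; rewrite !dual_BZ_SZ Ind_BZ_succ adm_dual_SZ.
by rewrite dual_SZK.
Qed.

(** * Duality modulo the confluence ideal *)

Lemma ideal0 (R : comNzRingType) (X : R -> Prop) : ideal_generated X 0.
Proof. by exists [::]; rewrite ?big_nil. Qed.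

Lemma idealD (R : comNzRingType) (X : R -> Prop) x y :
  ideal_generated X x -> ideal_generated X y -> ideal_generated X (x + y).
Proof.
move=> [s Xs ->] [t Xt ->]; exists (s ++ t); last by rewrite big_cat.
by move=> p; rewrite mem_cat => /orP[/Xs|/Xt].
Qed.

Lemma idealMl (R : comNzRingType) (X : R -> Prop) a x :
  ideal_generated X x -> ideal_generated X (a * x).
Proof.
move=> [s Xs ->]; exists [seq (a * p.1, p.2) | p <- s].
  by move=> p /mapP[q /Xs ? ->].
by rewrite big_map mulr_sumr; apply: eq_bigr => p _; rewrite mulrA.
Qed.

Lemma idealMr (R : comNzRingType) (X : R -> Prop) a x :
  ideal_generated X x -> ideal_generated X (x * a).
Proof. by rewrite mulrC; apply: idealMl. Qed.

Lemma idealN (R : comNzRingType) (X : R -> Prop) x :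
  ideal_generated X x -> ideal_generated X (- x).
Proof. by rewrite -mulN1r; apply: idealMl. Qed.

Lemma idealB (R : comNzRingType) (X : R -> Prop) x y :
  ideal_generated X x -> ideal_generated X y -> ideal_generated X (x - y).
Proof. by move=> Xx /idealN; apply: idealD. Qed.

Lemma ideal_gen (R : comNzRingType) (X : R -> Prop) x : X x -> ideal_generated X x.
Proof.
move=> Xx; exists [:: (1, x)]; last by rewrite big_seq1 mul1r.
by move=> p; rewrite inE => /eqP->.
Qed.

Lemma idealZ (X : Sym -> Prop) (c : rat) x :
  ideal_generated X x -> ideal_generated X (c *: x).
Proof. by rewrite -[x in _ *: x]mul1r scalerAl; apply: idealMl. Qed.

HB.instance Definition _ := GRing.Linear.copy sym_of (lext sym_word).
HB.instance Definition _ := GRing.Linear.copy m_odot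
  (lext (fun p : {fmonom nat} * {fmonom nat} => sym_word p.1 * sym_word p.2)).

Definition regs : Qw -> Sym := lext (fun w : {fmonom nat} => sym_of (reg << w >>)).
HB.instance Definition _ := GRing.Linear.on regs.

(** The left hand side of the confluence relations, as a function of phi_pi(u). *)
Definition evaluate : word_pairs -> Sym :=
  fun t => m_odot (tmap (fun w : {fmonom nat} => << w >>)
                        (fun w : {fmonom nat} => reg << w >>) t).
HB.instance Definition _ := GRing.Linear.copy evaluate
  (m_odot \o tmap (fun w : {fmonom nat} => << w >>) (fun w : {fmonom nat} => reg << w >>)).

Lemma lextM (K L : choiceType) (f : K -> Sym) (g : L -> Sym) u v :
  lext f u * lext g v = lext (fun k => lext (fun l => f k * g l) v) u.
Proof.
rewrite /lext mulr_suml; apply: eq_bigr => k _; rewrite -scalerAl mulr_sumr.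
by apply: (congr1 ( *:%R _)); apply: eq_bigr => l _; rewrite malg_scalerAr.
Qed.

Lemma m_odot_tens u v : m_odot (tens u v) = sym_of u * sym_of v.
Proof.
apply: etrans (linear_tens m_odot _ _) _; rewrite /sym_of lextM.
by apply: eq_lext => k _; apply: eq_lext => l _; apply: (lextU _ (k, l)).
Qed.

Lemma evaluate_tens u v : evaluate (tens u v) = sym_of u * regs v.
Proof.
rewrite /evaluate tmapE m_odot_tens lext_basis; apply: (congr1 ( *%R _)).
exact: (linear_lext sym_of).
Qed.

Lemma supported1 : supported adm 1.
Proof.
by rewrite one_word => w /(fsubsetP msuppU_le); rewrite in_fset1 => /eqP->.
Qed.

Lemma regs1 : regs 1 = sym_of 1.
Proof.
rewrite one_word /regs lextU -/(word [::]) -one_word.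
by rewrite (reg_adm supported1).
Qed.

Lemma I_CF_confluence u : carried in_G u ->
  I_CF_alg (evaluate (phi_pi u) - sym_of (Defs.pi (at_z1 u))).
Proof. by move=> Gu; apply: ideal_gen; right; exists u. Qed.

Lemma I_CF_one : I_CF_alg (sym_of 1 - 1).
Proof. by apply: ideal_gen; left. Qed.

Lemma V_BZ_tens_ind (P : word_pairs -> Prop) t :
  P 0 -> (forall x y, P x -> P y -> P (x + y)) -> (forall c x, P x -> P (c *: x)) ->
  (forall k v, Ind_BZ k -> P (tens (F_BZ k) v)) -> V_BZ_tens t -> P t.
Proof.
move=> P0 PD PZ PF [s sV ->]; rewrite big_seq; apply: big_ind => // -[u v] /sV[c cI /= ->].
by rewrite tens_lextl; apply: lext_closed => // k /cI /PF.
Qed.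

Lemma V_BZ_tens_eq (V : lmodType rat) (L1 L2 : {linear word_pairs -> V}) :
  (forall k v, Ind_BZ k -> L1 (tens (F_BZ k) v) = L2 (tens (F_BZ k) v)) ->
  forall t, V_BZ_tens t -> L1 t = L2 t.
Proof.
move=> L12 t [s sV ->]; rewrite !linear_sum; apply: eq_big_seq => -[u v] /sV[c cI /= ->].
by rewrite tens_lextl !linear_lext; apply: eq_lext => k /cI kI; apply: L12.
Qed.

HB.instance Definition _ := GRing.Linear.copy tau_BZ_id
  (tmap (fun w : {fmonom nat} => tau_BZ << w >>) (fun w : {fmonom nat} => << w >>)).

Lemma tau_BZ_id_F k v : Ind_BZ k ->
  tau_BZ_id (tens (F_BZ k) v) = tens (F_BZ (dual_BZ k)) v.
Proof.
move=> kI; apply: etrans (tmapE _ _ _ _) _; rewrite lext_basis.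
by rewrite -(linear_basisE tau_BZ) tau_BZ_F.
Qed.

Definition unpair_left : word_pairs -> word_pairs :=
  tmap (fun w : {fmonom nat} => unpair << w >>) (fun w : {fmonom nat} => << w >>).

HB.instance Definition _ := GRing.Linear.on unpair_left.

Lemma unpair_left_F k v : all (leq 1) k ->
  unpair_left (tens (F_BZ k) v) = tens (word k) v.
Proof.
move=> k0; apply: etrans (tmapE _ _ _ _) _; rewrite lext_basis.
by rewrite -(linear_basisE unpair) /= unpair_F_BZ.
Qed.

Definition defect (k : seq nat) : Sym := sym_of (F_BZ k) - sym_of (F_BZ (dual_BZ k)).

(** On [unpair_left t], which is the expansion of t in the basis F_BZ(k), this is the
effect of tau_BZ on the evaluation of t. *)
Definition total_defect : word_pairs -> Sym :=
  lext (fun p : {fmonom nat} * {fmonom nat} => defect p.1 * sym_of (reg << p.2 >>)).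

HB.instance Definition _ := GRing.Linear.on total_defect.

Lemma total_defect_tens k v : total_defect (tens (word k) v) = defect k * regs v.
Proof.
have -> : defect k = lext (fun s : {fmonom nat} => defect s) (word k) by rewrite lextU.
rewrite /regs lextM; apply: etrans (linear_tens total_defect _ _) _.
by apply: eq_lext => s _; apply: eq_lext => l _; apply: (lextU _ (s, l)).
Qed.

Lemma evaluate_tau_BZ t : V_BZ_tens t ->
  evaluate t - evaluate (tau_BZ_id t) = total_defect (unpair_left t).
Proof.
pose L1 : {linear word_pairs -> Sym} := evaluate \- (evaluate \o tau_BZ_id).
pose L2 : {linear word_pairs -> Sym} := total_defect \o unpair_left.
apply: (@V_BZ_tens_eq _ L1 L2) => k v kI.
have [k0 _] := andP kI; rewrite /L1 /L2 /= tau_BZ_id_F // unpair_left_F //.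
rewrite total_defect_tens.
apply: etrans (congr2 (fun x y => x - y) (evaluate_tens _ _) (evaluate_tens _ _)) _.
by rewrite -mulrBl.
Qed.

Lemma carried_Theta_G k : Ind_BZ k ->
  carried in_G (Theta k) /\ carried in_G (lext (fun w : symb => << zq w >>) (Theta k)).
Proof.
move=> kI; split; first by apply: carried_Theta => e se; have [] := in_G_Theta kI se.
apply: carried_lext; apply: carried_Theta => e se; apply: carriedU.
by have [] := in_G_Theta kI se.
Qed.

Lemma evaluate_Theta k : Ind_BZ k -> k != [::] -> I_CF_alg (evaluate (phi_pi (Theta k))).
Proof.
case: k => // x k kI _; have := I_CF_confluence (proj1 (carried_Theta_G kI)).
by rewrite at_z1_Theta /Defs.pi linear0 linear0 subr0.
Qed.

Definition BZ_symmetric : Prop := forall k : seq nat, Ind_BZ k ->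
  V_BZ_tens (phi_pi (Theta k)) /\
  phi_pi (Theta k) = tau_BZ_id (phi_pi (Theta (dual_BZ k))).

(** The relations of k and of its dual give sum_l defect(l) * reg(w_l) = 0, where
phi_pi(Theta(k)) = sum_l F_BZ(l) (x) w_l.  Here w_k = 1, and the other indices l
have smaller weight. *)
Lemma BZ_duality : BZ_symmetric -> forall k, Ind_BZ k -> I_CF_alg (defect k).
Proof.
move=> H k; have [n] := ubnP (sumn k); elim: n k => // n IHn k; rewrite ltnS => kn kI.
have [kI' kK] := dual_BZK kI; have [-> | k_nil] := eqVneq k [::].
  by rewrite /defect subrr; apply: ideal0.
have k'_nil : dual_BZ k != [::].
  by apply: contra_neq k_nil => Dk; rewrite -kK Dk.
have [VX _] := H k kI; have [_] := H _ kI'; rewrite kK => DX.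
set X := phi_pi (Theta k) in VX DX; have [k0 _] := andP kI.
have JX : I_CF_alg (total_defect (unpair_left X)).
  rewrite -evaluate_tau_BZ // -DX.
  by apply: idealB; apply: evaluate_Theta.
have uB x y : unpair_left (x - y) = unpair_left x - unpair_left y by exact: linearB.
have uD x y : unpair_left (x + y) = unpair_left x + unpair_left y by exact: linearD.
have uZ c x : unpair_left (c *: x) = c *: unpair_left x by exact: linearZ.
have dB x y : total_defect (x - y) = total_defect x - total_defect y by exact: linearB.
(* The coordinates of X in the basis F_BZ, without the leading term at k. *)
pose Y := unpair_left (X - tens (F_BZ k) 1).
have DY : Y = unpair_left X - tens (word k) 1.
  apply: etrans (uB _ _) _; apply: (congr1 (fun z => unpair_left X - z)).
  exact: unpair_left_F.
have YI : carried (fun p : {fmonom nat} * {fmonom nat} => Ind_BZ p.1) Y.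
  rewrite DY.
  have tI k' v : Ind_BZ k' ->
      carried (fun p : {fmonom nat} * {fmonom nat} => Ind_BZ p.1) (tens (word k') v).
    by move=> k'I; rewrite tensUl; apply: carried_lext => l _; apply: carriedU.
  apply: carriedD; last by apply: carriedN; apply: tI.
  pose P t := carried (fun p : {fmonom nat} * {fmonom nat} => Ind_BZ p.1) (unpair_left t).
  apply: (V_BZ_tens_ind (P := P)) VX => [|x y Ix Iy|c x Ix|k' v k'I]; rewrite /P.
  - by rewrite linear0; apply: carried0.
  - by rewrite uD; exact: (carriedD Ix Iy).
  - by rewrite uZ; exact: (@carriedZ _ _ c _ Ix).
  by rewrite unpair_left_F; [apply: tI | case/andP: k'I].
have Yk : carried (fun p : {fmonom nat} * {fmonom nat} => (sumn p.1 < sumn k)%N) Y.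
  apply: carried_lext => -[w w'] /(phi_pi_Theta k0) /= wk.
  apply: carried_tens => s l; rewrite word_fm => /weight_le_unpair sw _ /=.
  exact: leq_ltn_trans sw wk.
have JY : I_CF_alg (total_defect Y).
  apply: lext_closed; [exact: ideal0 | exact: idealD | exact: idealZ |].
  move=> p pY; apply: idealMr; apply: IHn (YI p pY).
  exact: leq_trans (Yk p pY) kn.
(* The regularization of the empty word is 1 in degree one, not the unit. *)
have Jk : I_CF_alg (defect k * sym_of 1).
  have -> : defect k * sym_of 1 = total_defect (unpair_left X) - total_defect Y.
    rewrite -regs1 -total_defect_tens -dB; apply: congr1.
    by rewrite DY opprB addrC subrK.
  exact: (idealB JX JY).
have -> : defect k = defect k * sym_of 1 - defect k * (sym_of 1 - 1).
  by rewrite -mulrBr opprB addrC subrK mulr1.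
exact: (idealB Jk (idealMl (defect k) I_CF_one)).
Qed.

(** Once the BZ duality is known, tau_BZ on the left factor has no effect modulo the
ideal, whatever is done to the right factor. *)
Lemma evaluate_raise_tau_BZ : BZ_symmetric -> forall t, V_BZ_tens t ->
  I_CF_alg (evaluate (raise_right t) - evaluate (raise_right (tau_BZ_id t))).
Proof.
move=> H t Vt.
pose L : {linear word_pairs -> Sym} :=
  (evaluate \o raise_right) \- (evaluate \o (raise_right \o tau_BZ_id)).
pose P t := I_CF_alg (L t).
apply: (V_BZ_tens_ind (P := P)) Vt => [|x y Jx Jy|c x Jx|k v kI]; rewrite /P.
- by rewrite linear0; apply: ideal0.
- by rewrite linearD; exact: (idealD Jx Jy).
- by rewrite linearZ; exact: (idealZ c Jx).
have e1 u : evaluate (raise_right (tens u v)) = sym_of u * regs (raise v).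
  by rewrite raise_right_tens evaluate_tens.
have -> : L (tens (F_BZ k) v) = defect k * regs (raise v).
  rewrite /L /= tau_BZ_id_F //.
  by apply: etrans (congr2 (fun x y => x - y) (e1 _) (e1 _)) _; rewrite -mulrBl.
exact: (idealMr (regs (raise v)) (BZ_duality H kI)).
Qed.

(** With k = w + 1, the confluence relations at zq of k and of its dual have
equivalent left hand sides, and right hand sides w and dual w. *)
Lemma SZ_duality : BZ_symmetric -> forall w : {fmonom nat}, adm w ->
  I_CF_alg (sym_of (word w) - sym_of (word (dual_SZ w))).
Proof.
move=> H w aw; pose k := map succn w.
have kI : Ind_BZ k by rewrite Ind_BZ_succ.
have [kI' _] := dual_BZK kI.
have gen l : Ind_BZ l ->
    I_CF_alg (evaluate (raise_right (phi_pi (Theta l))) - sym_of (word (map predn l))).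
  move=> lI; have := I_CF_confluence (proj2 (carried_Theta_G lI)).
  have [l0 _] := andP lI.
  have tl : carried (fun u => tame 0 u /\ tame (-1) u) (Theta l).
    by apply: carried_Theta => e se; apply: tame_Theta.
  by rewrite (pi_at_z1_zq_Theta l0) (phi_pi_zq tl).
have predK (s : seq nat) : map predn (map succn s) = s.
  by rewrite -map_comp -[RHS]map_id.
have g1 := gen _ kI; have g2 := gen _ kI'.
have Dk' : map predn (dual_BZ k) = dual_SZ w by rewrite /k dual_BZ_SZ predK.
rewrite Dk' in g2; rewrite predK in g1.
have [VX' _] := H _ kI'; have [_ DX] := H k kI.
have J := evaluate_raise_tau_BZ H VX'; rewrite -DX in J.
(* x and y are the evaluations at zq for k and for its dual, s and t the words. *)
have telescope (R : comNzRingType) (x y s t : R) : s - t = (y - t) - (x - s) - (y - x).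
  by ring.
rewrite (telescope _ (evaluate (raise_right (phi_pi (Theta k))))
  (evaluate (raise_right (phi_pi (Theta (dual_BZ k)))))).
exact: (idealB (idealB g2 g1) J).
Qed.

Theorem theorem42 :
  (forall k : seq nat, Ind_BZ k ->
     V_BZ_tens (phi_pi (Theta k)) /\
     phi_pi (Theta k) = tau_BZ_id (phi_pi (Theta (dual_BZ k)))) ->
  forall v : Qw, I_SZ_dual v -> I_CF v.
Proof.
move=> H v [u au ->]; split.
  have: carried (fun w : {fmonom nat} => adm w) (u - tau_SZ u).
    apply: carriedD => //; apply: carriedN; apply: carried_lext => w _.
    by apply: carriedU; apply: adm_dual_SZ.
  by [].
have -> : sym_of (u - tau_SZ u) =
    lext (fun w : {fmonom nat} => sym_of (word w) - sym_of (word (dual_SZ w))) u.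
  apply: etrans (linearB _ _ _) _.
  apply: etrans (congr2 (fun x y => x - y) (linear_basisE sym_of u)
    (linear_lext sym_of _ u)) _.
  apply: etrans (lextB _ _ _) _; apply: eq_lext => w _.
  by rewrite word_fm.
apply: lext_closed; [exact: ideal0 | exact: idealD | exact: idealZ |].
by move=> w /au aw; apply: SZ_duality.
Qed.
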